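(* There is a constant $M\geq1$, depending only on $f$, $D$ and the fixed constant $\alpha$, such that the following holds. Let $\nu\in(0,\nu_0]$ and, for integers $k\geq1$, let $$E(k)=\Bigg\{\frac{\sum_{|n|\in[M^{-1}k,Mk]}|\hat u(n)|^2}{\sum_{|n|\in[M^{-1}k,Mk]}1}\Bigg\},$$ where the sums are over $n\in\mathbb{Z}$ and $\hat u(n)=\hat u(t,n)$ is the $n$-th complex Fourier coefficient of $u(t,\cdot)$. Then for all $k$ such that $k^{-1}\in J_2=(C_1\nu^\beta,C_2]$ we have $$E(k)\sim k^{-2}.$$
   Context: Setting. $S^1=\mathbb{R}/\mathbb{Z}$; $\alpha\in(1,2)$ is a fixed constant, $\beta=1/(\alpha-1)$, $\nu\in(0,1]$. $\Lambda=\sqrt{-\Delta}$, so $\Lambda^\alpha$ is the Fourier multiplier by $(2\pi|k|)^\alpha$, $k\in\mathbb{Z}$. The function $f:\mathbb{R}\to\mathbb{R}$ is $C^\infty$, satisfies $f''\geq\sigma>0$ on $\mathbb{R}$, and for each integer $m\geq0$ there are $h(m)\geq0$, $C_m>0$ with $|f^{(m)}(x)|\leq C_m(1+|x|)^{h(m)}$ for all $x\in\mathbb{R}$, where $1\leq h(1)<2$. The initial condition $u_0:S^1\to\mathbb{R}$ is $C^\infty$, has zero mean and is not identically zero; $u=u(t,x)$ is the (global, smooth, zero space average) solution of $$u_t+(f(u))_x+\nu\Lambda^\alpha u=0,\quad t\geq0,\ x\in S^1,\qquad u(0)=u_0.$$ Norms (for zero-mean functions $v$ on $S^1$). $|v|_p$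 is the $L_p(S^1)$ norm; $|v|_{m,p}=|d^mv/dx^m|_p$ for integer $m\geq0$; $\|v\|_s=(2\pi)^s\big(\sum_{k\in\mathbb{Z}}|k|^{2s}|\hat v^k|^2\big)^{1/2}$ for real $s\geq0$. $D=\max(|u_0|_1^{-1},|u_0|_{1,\infty})>1$. Constants. $X\lesssim Y$ means $X\leq CY$ with $C>0$ depending only on $f$, $D$ and the fixed constant $\alpha$ (in particular independent of $\nu$ and $k$); $X\sim Y$ means $X\lesssim Y$ and $Y\lesssim X$. Time average. Fix a constant $\tilde C>0$ depending only on $f,D,\alpha$ such that $\|u(t)\|_{\alpha/2}^2\leq\tilde C\nu^{-1}$ for all $t\geq0$ (such a constant exists). Put $T_1=\frac14D^{-2}\tilde C^{-1}$, $T_2=\max\big(\frac32T_1,\,2D\sigma^{-1}\big)$, and $\lbrace A(t)\rbrace=\frac1{T_2-T_1}\int_{T_1}^{T_2}A(s)\,ds$. Choice of $C_1,C_2,\nu_0$. For $K>1$ let $L_K$ be the set of $t\in[T_1,T_2]$ such that $K^{-1}\leq|u(t)|_\infty\leq\max_x u_x(t,x)\leq K$, $K^{-1}\nu^{-\beta}\leq|u(t)|_{1,\infty}\leq K\nu^{-\beta}$ and $|u(t)|_{2,\infty}\leq K\nu^{-2\beta}$. There exist constants $C>0$ and $K_1>1$ depending only on $f,D,\alpha$ such that for every $K\geq K_1$ the Lebesgue measure of $L_K$ is at least $C$. Fix such $C$, $K_1$, set $K=K_1$ and $$\nu_0=\Big(\tfrac16K^{-2}\Big)^{1/\beta},\qquad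 C_1=\tfrac14K^{-2},\qquad C_2=\tfrac1{20}K^{-4}.$$ *)

(* Defs.v *)
From HB Require Import structures.
From mathcomp Require Import all_boot all_order all_algebra.
From mathcomp Require Import all_classical all_reals all_analysis.
From mathcomp Require Import complex.

Set Implicit Arguments.
Unset Strict Implicit.
Unset Printing Implicit Defensive.

Import Order.TTheory GRing.Theory Num.Theory.
Import numFieldNormedType.Exports.

Local Open Scope ring_scope.
Local Open Scope classical_set_scope.

(** Functions on the circle R/Z are represented by 1-periodic functions on R,
    and the torus integral by the integral over [0, 1]. *)

Definition periodic1 {R : realType} (v : R -> R) : Prop :=
  forall x, v (x + 1) = v x.

Definition smooth {R : realType} (v : R -> R) : Prop :=
  forall (m : nat) (x : R), derivable (v^`(m)) x 1.

Definition torus_int {R : realType} (v : R -> R) : R :=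
  \int[lebesgue_measure]_(x in `[0, 1]) v x.

(** Complex Fourier coefficient: the integral of v(x) e^{-2 i pi n x}. *)
Definition fourier {R : realType} (v : R -> R) (n : int) : R[i] :=
  Complex
    (torus_int (fun x => v x * cos (2 * pi * n%:~R * x)))
    (- torus_int (fun x => v x * sin (2 * pi * n%:~R * x))).

(** e^{2 i pi n x} *)
Definition fourier_mode {R : realType} (n : int) (x : R) : R[i] :=
  Complex (cos (2 * pi * n%:~R * x)) (sin (2 * pi * n%:~R * x)).

Definition sq_modulus {R : realType} (z : R[i]) : R :=
  ComplexField.Normc.normc z ^+ 2.

(** The Fourier multiplier by (2 pi |n|)^a, as the limit of the symmetric
    partial sums of the series of (2 pi |n|)^a v^(n) e^{2 i pi n x}.  For real
    v these partial sums are real, so taking real parts loses nothing. *)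
Definition fracLap {R : realType} (a : R) (v : R -> R) (x : R) : R :=
  lim ((fun N : nat =>
    \sum_(n \in [set n : int | (absz n <= N)%N])
      (2 * pi * `|n%:~R|) `^ a
        * complex.Re (fourier v n * fourier_mode n x)) @ \oo).

(** Lebesgue measure on [0, 1]. *)
Definition torus_measure (R : realType) :
    {measure set (measurableTypeR R) -> \bar R} :=
  mrestr (@lebesgue_measure R) (measurable_itv `[(0 : R), 1]%R).

Definition Lp_norm {R : realType} (p : \bar R) (v : R -> R) : R :=
  fine ('N[torus_measure R]_p[EFin \o v])%E.

(** |v|_{m,p} *)
Definition Wmp_norm {R : realType} (m : nat) (p : \bar R) (v : R -> R) : R :=
  Lp_norm p (v^`(m)).

(** ||v||_s, with value +oo when the series diverges. *)
Definition Hs_norm {R : realType} (s : R) (v : R -> R) : \bar R :=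
  (((2 * pi) `^ s)%:E *
   ((\esum_(n in [set: int])
       ((`|n%:~R| `^ (2 * s))%R * sq_modulus (fourier v n))%:E) `^ (2^-1)))%E.

Definition flux {R : realType} (sigma : R) (f : R -> R) : Prop :=
  [/\ smooth f,
      0 < sigma,
      forall x, sigma <= f^`(2) x &
      exists h : nat -> R,
        [/\ forall m, 0 <= h m,
            1 <= h 1%N < 2 &
            forall m, exists2 C : R, 0 < C &
              forall x, `|f^`(m) x| <= C * (1 + `|x|) `^ h m]].

(** Initial data; the last condition fixes the value of the parameter D. *)
Definition initial_datum {R : realType} (D : R) (u0 : R -> R) : Prop :=
  [/\ smooth u0, periodic1 u0, torus_int u0 = 0, exists x : R, u0 x != 0 &
      D = Num.max (Wmp_norm 0 1%E u0)^-1 (Wmp_norm 1 +oo%E u0)].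

(** Functions u t x matter only for t >= 0, hence the time derivative is taken
    relative to [0, +oo[: two-sided for t > 0 and one-sided at t = 0. *)
Definition dt_quotient {R : realType} (u : R -> R -> R) (t x h : R) : R :=
  h^-1 * (u (t + h) x - u t x).

Definition dt_filter {R : realType} (t : R) : set_system R :=
  within [set h : R | 0 <= t + h] (0 : R)^'.

Definition dt {R : realType} (u : R -> R -> R) : R -> R -> R :=
  fun t x => lim (dt_quotient u t x @ dt_filter t).

Definition dx {R : realType} (u : R -> R -> R) : R -> R -> R :=
  fun t x => (u t)^`() x.

(** C^m regularity on [0, +oo[ x R. *)
Fixpoint Cm_halfplane {R : realType} (m : nat) (u : R -> R -> R) : Prop :=
  {within [set p : R * R | 0 <= p.1], continuous (fun p => u p.1 p.2)} /\
  if m is m'.+1 then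
    [/\ forall t x : R, 0 <= t -> cvg (dt_quotient u t x @ dt_filter t),
        forall t x : R, 0 <= t -> derivable (u t) x 1,
        Cm_halfplane m' (dt u) &
        Cm_halfplane m' (dx u)]
  else True.

Definition smooth_halfplane {R : realType} (u : R -> R -> R) : Prop :=
  forall m, Cm_halfplane m u.

Definition solution {R : realType} (alpha : R) (f : R -> R) (nu : R)
    (u0 : R -> R) (u : R -> R -> R) : Prop :=
  [/\ smooth_halfplane u,
      forall t : R, 0 <= t -> periodic1 (u t),
      forall t : R, 0 <= t -> torus_int (u t) = 0,
      u 0 = u0 &
      forall t x : R, 0 <= t ->
        dt u t x + derive1 (f \o u t) x + nu * fracLap alpha (u t) x = 0].

Definition betaexp {R : realType} (alpha : R) : R := (alpha - 1)^-1.

Definition T1 {R : realType} (D Ct : R) : R := 4^-1 * D ^- 2 * Ct^-1.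

Definition T2 {R : realType} (sigma D Ct : R) : R :=
  Num.max (3 / 2 * T1 D Ct) (2 * D * sigma^-1).

Definition time_average {R : realType} (t1 t2 : R) (A : R -> R) : R :=
  (t2 - t1)^-1 * \int[lebesgue_measure]_(s in `[t1, t2]) A s.

Definition L_set {R : realType} (alpha t1 t2 nu K : R) (u : R -> R -> R) :
    set R :=
  [set t | [/\ t1 <= t <= t2,
      K^-1 <= Wmp_norm 0 +oo%E (u t) <= sup (range (dx u t)),
      sup (range (dx u t)) <= K,
      K^-1 * nu `^ (- betaexp alpha) <= Wmp_norm 1 +oo%E (u t)
        <= K * nu `^ (- betaexp alpha) &
      Wmp_norm 2 +oo%E (u t) <= K * nu `^ (- (2 * betaexp alpha))]].

(** Ct is an admissible constant in the bound ||u(t)||_{alpha/2}^2 <= Ct / nu,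
    uniformly over all solutions with the same f, D, alpha. *)
Definition energy_constant {R : realType} (alpha : R) (f : R -> R)
    (D Ct : R) : Prop :=
  0 < Ct /\
  forall (nu : R) (u0 : R -> R) (u : R -> R -> R),
    0 < nu <= 1 -> initial_datum D u0 -> solution alpha f nu u0 u ->
    forall t : R, 0 <= t ->
      (Hs_norm (alpha / 2) (u t) ^+ 2 <= (Ct * nu^-1)%:E)%E.

(** C and K1 are admissible constants in the lower bound on the measure of
    L_K, K >= K1, uniformly over all solutions with the same f, D, alpha. *)
Definition L_constants {R : realType} (alpha sigma : R) (f : R -> R)
    (D Ct C K1 : R) : Prop :=
  [/\ 0 < C, 1 < K1 &
  forall K : R, K1 <= K ->
  forall (nu : R) (u0 : R -> R) (u : R -> R -> R),
    0 < nu <= 1 -> initial_datum D u0 -> solution alpha f nu u0 u ->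
    (C%:E <= lebesgue_measure
       (L_set alpha (T1 D Ct) (T2 sigma D Ct) nu K u))%E].

Definition nu_0 {R : realType} (alpha K : R) : R :=
  (6^-1 * K ^- 2) `^ (betaexp alpha)^-1.

Definition C_1 {R : realType} (K : R) : R := 4^-1 * K ^- 2.

Definition C_2 {R : realType} (K : R) : R := 20^-1 * K ^- 4.

Definition shell {R : realType} (M : R) (k : nat) : set int :=
  [set n : int | M^-1 * k%:R <= `|n%:~R| <= M * k%:R].

Definition spectrum {R : realType} (t1 t2 M : R) (u : R -> R -> R) (k : nat) :
    R :=
  time_average t1 t2 (fun t =>
    (\sum_(n \in shell M k) sq_modulus (fourier (u t) n))
      / (\sum_(n \in shell M k) (1 : R))).

(* Main.v *)
Require Import Defs.
From mathcomp Require Import all_boot all_order all_algebra.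
From mathcomp Require Import all_classical all_reals all_analysis.
From mathcomp Require Import measurable_realfun ess_sup_inf complex ring lra.

(** The estimate follows from two facts about u: a one-sided bound on u_x at
    every time, and a cliff at every time of L_K.

    Upper bound.  Since u_x has zero mean and u_x <= D, its L^1 norm is at most
    2 D; hence n^2 |u^(n)|^2 <= D^2 ([mode_energy_bound]) and every shell mean
    is of order at most k^-2, at every time.  The inequality u_x <= D is
    obtained from a maximum principle for u(t, y + h) - u(t, y) - D h
    ([one_sided_lipschitz]).  Working with increments avoids differentiating
    the equation: at a positive maximum both slopes equal D, the time
    derivative of the increment is nonnegative, and the equation makes it
    negative, because f' is increasing and because the dissipation is larger at
    the upper point.

    This last sign ([fracLap_le]) has to be read off the Fourier series that
    defines the fractional Laplacian.  The substitution s -> s + ln n shows that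
    n^alpha is a constant multiple of the integral over s of
    (1 - cos (2 pi n e^s)) e^(- alpha s).  A series with weights n^alpha is
    therefore an average of second differences of the function, up to a tail
    controlled by the decay of the coefficients.  Second differences are
    recovered from the coefficients by pointwise Fourier inversion, proved with
    the Fejer kernel.

    Lower bound.  At a time of L_K there is a point where
    u_x <= - K^-1 nu^-beta, and the bound on u_xx keeps u_x that steep on a
    width comparable to nu^beta.  Since u_x <= K elsewhere, u drops by a fixed
    amount over any window of length l containing the cliff, provided that
    C_1 nu^beta < l <= C_2, so the integral of (u(x + l) - u(x))^2 is at least
    a multiple of l ([cliff_increment]).  By Parseval that integral is the
    sum of 4 (1 - cos (2 pi n l)) |u^(n)|^2 over n >= 1.  Take l = 1/k.  Frequencies below k/M
    contribute O(l/M), because 1 - cos is quadratic at 0 and n^2 |u^(n)|^2 is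
    bounded, and frequencies above M k contribute O(l/M), because the sum of
    n^-2 beyond M k is at most 1/(M k).  For M large the shell carries a fixed
    fraction of l ([shell_lower_bound]); it contains at most 2 M k frequencies,
    so its mean is at least a multiple of k^-2.  This holds on L_K, whose
    measure is at least C ([le_time_average]). *)

Set Implicit Arguments.
Unset Strict Implicit.
Unset Printing Implicit Defensive.

Import Order.TTheory GRing.Theory Num.Theory.
Import numFieldNormedType.Exports.

Local Open Scope ring_scope.
Local Open Scope classical_set_scope.

Local Notation "f ^` ()" := (derive1 f) : ring_scope.

(** * Integration over the circle *)

Section TorusIntegral.
Context {R : realType}.
Implicit Types (v w : R -> R) (a b c x : R).

Lemma continuous_itv_integrable v a b : continuous v ->
  (@lebesgue_measure R).-integrable `[a, b] (EFin \o v).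
Proof.
move=> cv; apply: continuous_compact_integrable; first exact: segment_compact.
exact: continuous_subspaceT.
Qed.

Lemma derivable_continuous v : (forall x, derivable v x 1) -> continuous v.
Proof. by move=> dv x; apply/differentiable_continuous/derivable1_diffP. Qed.

Lemma eq_torus_int v w : v =1 w -> torus_int v = torus_int w.
Proof. by move=> vw; apply: eq_Rintegral => x _; exact: vw. Qed.

Lemma torus_intD v w : continuous v -> continuous w ->
  torus_int (fun x => v x + w x) = torus_int v + torus_int w.
Proof.
by move=> cv cw; apply: RintegralD => //; exact: continuous_itv_integrable.
Qed.

Lemma torus_intB v w : continuous v -> continuous w ->
  torus_int (fun x => v x - w x) = torus_int v - torus_int w.
Proof.
by move=> cv cw; apply: RintegralB => //; exact: continuous_itv_integrable.
Qed.

Lemma torus_intZ c v : continuous v ->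
  torus_int (fun x => c * v x) = c * torus_int v.
Proof.
by move=> cv; apply: RintegralZl => //; exact: continuous_itv_integrable.
Qed.

Lemma torus_int_cst c : torus_int (fun=> c) = c.
Proof.
rewrite /torus_int Rintegral_cst//= lebesgue_measure_itv/= lte_fin ltr01.
by rewrite oppr0 adde0 mulr1.
Qed.

Lemma le_torus_int v w : continuous v -> continuous w ->
  (forall x, 0 <= x <= 1 -> v x <= w x) -> torus_int v <= torus_int w.
Proof.
move=> cv cw vw; apply: le_Rintegral => //; exact: continuous_itv_integrable.
Qed.

Lemma le_norm_torus_int v w : continuous v -> continuous w ->
  (forall x, 0 <= x <= 1 -> `|v x| <= w x) -> `|torus_int v| <= torus_int w.
Proof.
move=> cv cw vw; rewrite ler_norml; apply/andP; split.
  have -> : - torus_int w = torus_int (fun x => -1 * w x).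
    by rewrite torus_intZ// mulN1r.
  apply: le_torus_int => //.
    by move=> x; apply: cvgM; [exact: cvg_cst|exact: cw].
  by move=> x /vw; rewrite ler_norml mulN1r => /andP[].
by apply: le_torus_int => // x /vw; rewrite ler_norml => /andP[].
Qed.

Lemma continuous_sum (n : nat) (F : nat -> R -> R) :
  (forall i, continuous (F i)) -> continuous (fun x => \sum_(i < n) F i x).
Proof.
move=> cF; elim: n => [|n IHn].
  by under eq_fun do rewrite big_ord0; exact: cst_continuous.
under eq_fun do rewrite big_ord_recr/=.
by move=> x; apply: cvgD; [exact: IHn|exact: cF].
Qed.

Lemma torus_int_sum (n : nat) (F : nat -> R -> R) :
  (forall i, continuous (F i)) ->
  torus_int (fun x => \sum_(i < n) F i x) = \sum_(i < n) torus_int (F i).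
Proof.
move=> cF; elim: n => [|n IHn].
  under eq_torus_int do rewrite big_ord0.
  by rewrite torus_int_cst big_ord0.
under eq_torus_int do rewrite big_ord_recr/=.
by rewrite torus_intD ?IHn ?big_ord_recr//; exact: continuous_sum.
Qed.

Lemma torus_int_by_parts v w :
    (forall x, derivable v x 1) -> (forall x, derivable w x 1) ->
    continuous v^`() -> continuous w^`() -> v 1 * w 1 = v 0 * w 0 ->
  torus_int (fun x => v x * w^`() x) = - torus_int (fun x => v^`() x * w x).
Proof.
move=> dv dw cv' cw' vw.
have cv := derivable_continuous dv; have cw := derivable_continuous dw.
have dLR (z : R -> R) : (forall x, derivable z x 1) ->
    derivable_oo_LRcontinuous z 0 1.
  move=> dz; have cz := derivable_continuous dz.
  split=> [x _||]; first exact: dz.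
  - by apply: cvg_at_right_filter; exact: cz.
  - by apply: cvg_at_left_filter; exact: cz.
have -> : torus_int (fun x => v x * w^`() x) =
    (v 1 * w 1 - v 0 * w 0) - torus_int (fun x => v^`() x * w x).
  apply: Rintegration_by_parts; first exact: ltr01.
  - by move=> x; apply: continuous_subspaceT.
  - exact: dLR.
  - by [].
  - by move=> x; apply: continuous_subspaceT.
  - exact: dLR.
  - by [].
by rewrite vw subrr sub0r.
Qed.

End TorusIntegral.


(** * Smooth periodic functions *)

Section SmoothPeriodic.
Context {R : realType}.
Implicit Types (v w : R -> R) (x : R) (m : nat).

Lemma smooth_deriv v : smooth v -> smooth v^`().
Proof. by move=> sv m x; rewrite -derive1Sn; exact: sv. Qed.

Lemma smooth_derivable v x : smooth v -> derivable v x 1.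
Proof. by move=> /(_ 0%N); exact. Qed.

Lemma smooth_continuous v : smooth v -> continuous v.
Proof. by move=> sv; apply: derivable_continuous => x; exact: smooth_derivable. Qed.

Lemma periodic_deriv v : periodic1 v -> periodic1 v^`().
Proof.
move=> pv x; rewrite /derive1.
suff -> : (fun h => h^-1 *: (v (h + (x + 1)) - v (x + 1))) =
          (fun h => h^-1 *: (v (h + x) - v x)) by [].
by apply/funext => h; rewrite addrA !pv.
Qed.

Lemma periodicz v (m : int) x : periodic1 v -> v (x + m%:~R) = v x.
Proof.
move=> pv.
have pn k y : v (y + k%:R) = v y.
  by elim: k => [|k IHk]; rewrite ?addr0// -natr1 addrA pv.
case: m => k; first exact: pn.
by rewrite NegzE mulrNz -[LHS](pn k.+1) subrK.
Qed.

Lemma periodic_reduce v x : periodic1 v ->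
  exists2 y : R, 0 <= y <= 1 & v x = v y.
Proof.
move=> pv; exists (x + (- Num.floor x)%:~R); last by rewrite periodicz.
rewrite mulrNz subr_ge0 floor_le_tmp/= lerBlDr addrC.
by have := floorD1_gt x; rewrite intrD => /ltW.
Qed.

Lemma periodic_bounded v : continuous v -> periodic1 v ->
  exists2 B, 0 <= B & forall x, `|v x| <= B.
Proof.
move=> cv pv.
have cnv : continuous (fun x => `|v x|) by move=> x; apply: cvg_norm; exact: cv.
have [c _ cmax] := EVT_max ler01 (continuous_subspaceT cnv).
exists `|v c| => // x.
have [y y01 ->] := periodic_reduce x pv.
by apply: cmax; rewrite in_itv.
Qed.

End SmoothPeriodic.

(** * Fourier coefficients and their decay *)

Section FourierCoefficients.
Context {R : realType}.
Implicit Types (v w : R -> R) (a b c x : R) (n : nat).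

Definition freq n : R := 2 * pi * n%:R.

(** The cosine and sine coefficients are the real part and minus the imaginary
    part of the Fourier coefficient of a real function.  They keep the analysis
    within real integrals. *)
Definition cos_coef v n : R := torus_int (fun x => v x * cos (freq n * x)).
Definition sin_coef v n : R := torus_int (fun x => v x * sin (freq n * x)).

#[global] Instance is_derive_cosM a x :
  is_derive x 1 (fun y => cos (a * y)) (- (a * sin (a * x))).
Proof.
have da : is_derive x 1 (fun y : R => a * y) a.
  by apply: is_derive_eq; rewrite scaler1.
apply: (is_derive_eq (@is_derive1_comp _ cos (fun y => a * y) x _ _ _ da)).
by rewrite mulNr mulrC.
Qed.

#[global] Instance is_derive_sinM a x :
  is_derive x 1 (fun y => sin (a * y)) (a * cos (a * x)).
Proof.
have da : is_derive x 1 (fun y : R => a * y) a.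
  by apply: is_derive_eq; rewrite scaler1.
apply: (is_derive_eq (@is_derive1_comp _ sin (fun y => a * y) x _ _ _ da)).
by rewrite mulrC.
Qed.

Lemma continuous_cosM a : continuous (fun x : R => cos (a * x)).
Proof. by apply: derivable_continuous => x; apply: ex_derive. Qed.

Lemma continuous_sinM a : continuous (fun x : R => sin (a * x)).
Proof. by apply: derivable_continuous => x; apply: ex_derive. Qed.

Lemma continuous_mul v w : continuous v -> continuous w ->
  continuous (fun x => v x * w x).
Proof. by move=> cv cw x; apply: cvgM; [exact: cv|exact: cw]. Qed.

Lemma freqS n : freq n.+1 = freq n + pi *+ 2.
Proof. by rewrite /freq -(@natr1 _ n) mulrDr mulr1 mulr_natl. Qed.

Lemma cos_freq n : cos (freq n) = 1.
Proof.
elim: n => [|n IHn]; first by rewrite /freq mulr0 cos0.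
by rewrite freqS cosD2pi.
Qed.

Lemma sin_freq n : sin (freq n) = 0.
Proof.
elim: n => [|n IHn]; first by rewrite /freq mulr0 sin0.
by rewrite freqS sinD2pi.
Qed.

Lemma cos_coef_deriv v n : smooth v -> periodic1 v ->
  cos_coef v^`() n = freq n * sin_coef v n.
Proof.
move=> sv pv; have cv := smooth_continuous sv.
have dc : (fun x => cos (freq n * x))^`() = (fun x => - (freq n * sin (freq n * x))).
  by apply/funext => x; rewrite derive1E derive_val.
have := @torus_int_by_parts R v (fun x => cos (freq n * x)).
rewrite dc => ibp.
rewrite /cos_coef -[LHS]opprK -ibp.
- rewrite -mulN1r -torus_intZ.
    rewrite /sin_coef -torus_intZ.
      by apply: eq_torus_int => x; ring.
    by apply: continuous_mul => //; exact: continuous_sinM.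
  apply: continuous_mul => // x; apply: cvgN; apply: cvgM; first exact: cvg_cst.
  exact: continuous_sinM.
- by move=> x; exact: smooth_derivable.
- by move=> x; exact: ex_derive.
- exact/smooth_continuous/smooth_deriv.
- move=> x; apply: cvgN; apply: cvgM; first exact: cvg_cst.
  exact: continuous_sinM.
- by rewrite mulr0 mulr1 cos0 cos_freq -(pv 0) add0r.
Qed.

Lemma sin_coef_deriv v n : smooth v -> periodic1 v ->
  sin_coef v^`() n = - (freq n * cos_coef v n).
Proof.
move=> sv pv; have cv := smooth_continuous sv.
have dc : (fun x => sin (freq n * x))^`() = (fun x => freq n * cos (freq n * x)).
  by apply/funext => x; rewrite derive1E derive_val.
have := @torus_int_by_parts R v (fun x => sin (freq n * x)).
rewrite dc => ibp.
rewrite /sin_coef -[LHS]opprK -ibp.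
- congr (- _).
  rewrite /cos_coef -torus_intZ.
    by apply: eq_torus_int => x; ring.
  by apply: continuous_mul => //; exact: continuous_cosM.
- by move=> x; exact: smooth_derivable.
- by move=> x; exact: ex_derive.
- exact/smooth_continuous/smooth_deriv.
- move=> x; apply: cvgM; first exact: cvg_cst.
  exact: continuous_cosM.
- by rewrite mulr0 mulr1 sin0 sin_freq !mulr0.
Qed.

Lemma cos_coef_bound v n B : continuous v -> (forall x, `|v x| <= B) ->
  `|cos_coef v n| <= B.
Proof.
move=> cv vB; rewrite -[leRHS]torus_int_cst; apply: le_norm_torus_int => //.
- by apply: continuous_mul => //; exact: continuous_cosM.
- exact: cst_continuous.
- move=> x _; rewrite normrM -[leRHS]mulr1; apply: ler_pM => //; exact: cos_max.
Qed.

Lemma sin_coef_bound v n B : continuous v -> (forall x, `|v x| <= B) ->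
  `|sin_coef v n| <= B.
Proof.
move=> cv vB; rewrite -[leRHS]torus_int_cst; apply: le_norm_torus_int => //.
- by apply: continuous_mul => //; exact: continuous_sinM.
- exact: cst_continuous.
- move=> x _; rewrite normrM -[leRHS]mulr1; apply: ler_pM => //; exact: sin_max.
Qed.

Lemma freq_ge n : n%:R <= freq n.
Proof. by rewrite /freq ler_peMl//; have := @pi_ge2 R; lra. Qed.

Lemma freq_ge0 n : 0 <= freq n.
Proof. exact: le_trans (freq_ge n). Qed.

Lemma coef_deriv2 v n : smooth v -> periodic1 v ->
  freq n ^+ 2 * cos_coef v n = - cos_coef v^`()^`() n /\
  freq n ^+ 2 * sin_coef v n = - sin_coef v^`()^`() n.
Proof.
move=> sv pv; have sv' := smooth_deriv sv; have pv' := periodic_deriv pv.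
rewrite (cos_coef_deriv n sv' pv') (sin_coef_deriv n sv' pv').
rewrite (cos_coef_deriv n sv pv) (sin_coef_deriv n sv pv).
by split; ring.
Qed.

(** Four integrations by parts; the fourth power leaves a summable factor n^-2
    after multiplication by n^alpha with alpha < 2. *)
Lemma coef_decay v : smooth v -> periodic1 v ->
  exists2 B, 0 <= B & forall n, n%:R ^+ 4 * `|cos_coef v n| <= B /\
                                n%:R ^+ 4 * `|sin_coef v n| <= B.
Proof.
move=> sv pv.
have sv2 := smooth_deriv (smooth_deriv sv).
have pv2 := periodic_deriv (periodic_deriv pv).
have sv4 := smooth_deriv (smooth_deriv sv2).
have pv4 := periodic_deriv (periodic_deriv pv2).
have cv4 := smooth_continuous sv4.
have [B B0 wB] := periodic_bounded cv4 pv4.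
exists B => // n.
have le4 z : n%:R ^+ 4 * `|z| <= `|freq n ^+ 2 * (freq n ^+ 2 * z)|.
  rewrite mulrA -exprD normrM ler_wpM2r// normrX ger0_norm ?freq_ge0//.
  by rewrite lerXn2r ?nnegrE ?freq_ge0 ?freq_ge.
have [c2 s2] := coef_deriv2 n sv pv.
have [c4 s4] := coef_deriv2 n sv2 pv2.
split; apply: le_trans (le4 _) _.
  by rewrite c2 mulrN c4 opprK; exact: cos_coef_bound.
by rewrite s2 mulrN s4 opprK; exact: sin_coef_bound.
Qed.

End FourierCoefficients.

(** * Mean value inequalities and bounds for the sine *)

Section Elementary.
Context {R : realType}.
Implicit Types (v w : R -> R) (a b c x y z : R) (n : nat).

Lemma derivable_MVT v a b : (forall x, derivable v x 1) -> a <= b ->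
  exists2 c, a <= c <= b & v b - v a = v^`() c * (b - a).
Proof.
move=> dv ab.
have [||c cab ->] := @MVT_segment R v v^`() a b ab.
- by move=> x _; rewrite derive1E; apply/derivableP.
- exact/continuous_subspaceT/derivable_continuous.
- by exists c => //; move: cab; rewrite in_itv.
Qed.

Lemma lipschitz_deriv v B x y : (forall x, derivable v x 1) ->
  (forall x, `|v^`() x| <= B) -> `|v x - v y| <= B * `|x - y|.
Proof.
move=> dv vB.
wlog xy : x y / y <= x.
  move=> hw; have [xy|/ltW yx] := leP y x; first exact: hw.
  by rewrite distrC (distrC x); exact: hw.
have [c _ ->] := derivable_MVT dv xy.
by rewrite normrM ler_wpM2r.
Qed.

Lemma norm_sin_le x : `|sin x| <= `|x|.
Proof.
have := @lipschitz_deriv sin 1 x 0; rewrite sin0 !subr0 mul1r; apply.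
  by move=> z; exact: derivable_sin.
by move=> z; rewrite derive1E derive_val; exact: cos_max.
Qed.

(** By duplication sin x = 2 sin (x/2) cos (x/2), and the mean value theorem
    gives sin (x/2) >= (x/2) cos (x/2), so sin x >= x (1 + cos x) / 2. *)
Lemma sin_ge_half x : 0 <= x <= pi / 2 -> x / 2 <= sin x.
Proof.
move=> /andP[x0 xpi].
have [c /andP[c0 cx] sE] := @derivable_MVT sin 0 (x / 2)
  (fun z => @derivable_sin R z) (divr_ge0 x0 (ler0n _ 2)).
have {}sE : sin (x / 2) = cos c * (x / 2).
  by move: sE; rewrite sin0 !subr0 derive1E derive_val.
have pi0 := @pi_gt0 R.
have cc : cos (x / 2) <= cos c.
  have [->//|cx'] := eqVneq c (x / 2).
  by apply: ltW; rewrite ltr_cos ?in_itv/=; [rewrite lt_neqAle cx'| |]; lra.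
have cx0 : 0 <= cos x by apply: cos_ge0_pihalf; lra.
have ch0 : 0 <= cos (x / 2) by apply: cos_ge0_pihalf; lra.
have xE : x = (x / 2) *+ 2 by rewrite -mulr_natr divfK.
have -> : sin x = 2 * (cos (x / 2) * sin (x / 2)).
  by rewrite {1}xE sin_mulr2n -mulr_natl.
have : cos x = cos (x / 2) ^+ 2 * 2 - 1.
  by rewrite {1}xE cos_mulr2n -mulr_natr.
rewrite sE => cE.
have : cos (x / 2) * cos (x / 2) <= cos (x / 2) * cos c by rewrite ler_wpM2l.
move=> /(ler_wpM2r x0); nra.
Qed.

Lemma norm_sin_pi_ge x : `|x| <= 2^-1 -> `|x| <= `|sin (pi * x)|.
Proof.
move=> xh.
have -> : `|sin (pi * x)| = `|sin (pi * `|x|)|.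
  have [x0|x0] := leP 0 x; first by rewrite (ger0_norm x0).
  by rewrite (ltr0_norm x0) mulrN sinN normrN.
have := @pi_ge2 R; have x0 := normr_ge0 x => p2.
apply: le_trans (ler_norm _); apply: le_trans (sin_ge_half _); nra.
Qed.

Lemma sin_pi_periodic : periodic1 (fun x : R => `|sin (pi * x)|).
Proof. by move=> x; rewrite mulrDr mulr1 sinDpi normrN. Qed.

(** The function |sin (pi z)| is a periodic substitute for the distance of z
    to the integers; it is the one that the Fejer kernel cancels exactly. *)
Lemma smooth_lipschitz_sin v : smooth v -> periodic1 v ->
  exists2 B, 0 <= B & forall x y, `|v x - v y| <= B * `|sin (pi * (x - y))|.
Proof.
move=> sv pv.
have [B B0 vB] := periodic_bounded (smooth_continuous (smooth_deriv sv))
  (periodic_deriv pv).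
exists B => // x y.
(* m is the integer nearest to x - y. *)
pose m := Num.floor (x - y + 2^-1).
have := @periodicz _ _ (- m) (x - y) sin_pi_periodic; rewrite /= => <-.
rewrite -(@periodicz _ v (- m) x)//.
apply: le_trans (@lipschitz_deriv v B _ _ _ vB) _.
  by move=> z; exact: smooth_derivable.
rewrite ler_wpM2l// addrAC; apply: norm_sin_pi_ge.
have := floor_le_tmp (x - y + 2^-1); have := floorD1_gt (x - y + 2^-1).
rewrite -/m intrD ler_norml mulrNz; lra.
Qed.

End Elementary.

(** * The Fejer kernel *)

Section Fejer.
Context {R : realType}.
Implicit Types (v w : R -> R) (a b c e x y z B : R) (n N m : nat).

(** For n > 0 the frequencies n and -n contribute this quantity each. *)
Definition harmonic_term v n x : R :=
  cos_coef v n * cos (freq n * x) + sin_coef v n * sin (freq n * x).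

Definition fourier_sum v N x : R :=
  cos_coef v 0 + \sum_(i < N) 2 * harmonic_term v i.+1 x.

Definition dirichlet N z : R := 1 + \sum_(i < N) 2 * cos (freq i.+1 * z).

Definition dirichlet_sum N z : R := \sum_(m < N) dirichlet m z.

Lemma continuous_dirichlet N x : continuous (fun y => dirichlet N (x - y)).
Proof.
move=> y; apply: cvgD; first exact: cvg_cst.
apply: (@continuous_sum _ N (fun i y => 2 * cos (freq i.+1 * (x - y)))) => i z.
apply: cvgM; first exact: cvg_cst.
apply: (@continuous_comp _ _ _ (fun y => freq i.+1 * (x - y)) cos).
  by apply: cvgM; [exact: cvg_cst|apply: cvgB; [exact: cvg_cst|exact: cvg_id]].
exact: continuous_cos.
Qed.

Lemma fourier_sum_dirichlet v N x : continuous v ->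
  fourier_sum v N x = torus_int (fun y => v y * dirichlet N (x - y)).
Proof.
move=> cv.
pose F i y := 2 * cos (freq i.+1 * x) * (v y * cos (freq i.+1 * y)) +
              2 * sin (freq i.+1 * x) * (v y * sin (freq i.+1 * y)).
have cc a : continuous (fun y => v y * cos (a * y)).
  by apply: continuous_mul => //; exact: continuous_cosM.
have cs a : continuous (fun y => v y * sin (a * y)).
  by apply: continuous_mul => //; exact: continuous_sinM.
have cZ a (w : R -> R) : continuous w -> continuous (fun y => a * w y).
  by move=> cw; apply: continuous_mul => //; exact: cst_continuous.
have cF i : continuous (F i).
  by move=> y; apply: cvgD; [exact: (cZ _ _ (cc _))|exact: (cZ _ _ (cs _))].
rewrite -(eq_torus_int (v := fun y => v y * cos (freq 0 * y) + \sum_(i < N) F i y)).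
  rewrite torus_intD//; last exact: continuous_sum.
  congr (_ + _); rewrite torus_int_sum//; apply: eq_bigr => i _.
  rewrite torus_intD; [|exact: cZ..].
  rewrite !torus_intZ// /harmonic_term /cos_coef /sin_coef; ring.
move=> y; rewrite {1}/freq mulr0 mul0r cos0 mulrDr; congr (_ + _).
rewrite mulr_sumr; apply: eq_bigr => i _.
by rewrite /F mulrBr cosB; ring.
Qed.

Lemma dirichlet_sin m z :
  dirichlet m z * sin (pi * z) = sin ((2 * m%:R + 1) * (pi * z)).
Proof.
elim: m => [|m IHm].
  by rewrite /dirichlet big_ord0 addr0 mulr0 add0r !mul1r.
rewrite /dirichlet big_ord_recr/= addrA mulrDl -/(dirichlet m z) IHm.
set t := pi * z.
have -> : freq m.+1 * z = (2 * m%:R + 1) * t + t.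
  by rewrite /freq /t -(@natr1 _ m); ring.
have -> : (2 * m.+1%:R + 1) * t = ((2 * m%:R + 1) * t + t) + t.
  by rewrite -(@natr1 _ m); ring.
rewrite [in RHS]sinD !cosD !sinD.
have := cos2Dsin2 t.
set S := sin _; set C := cos _; set s := sin _; set c := cos _.
move=> h; apply/eqP; rewrite -subr_eq0; apply/eqP.
transitivity (s * (1 - (C ^+ 2 + S ^+ 2))); first by ring.
by rewrite h subrr mulr0.
Qed.

Lemma dirichlet_sum_sin N z :
  dirichlet_sum N z * sin (pi * z) ^+ 2 = sin (N%:R * (pi * z)) ^+ 2.
Proof.
elim: N => [|N IHN].
  by rewrite /dirichlet_sum big_ord0 !mul0r sin0 expr0n.
rewrite /dirichlet_sum big_ord_recr/= mulrDl -/(dirichlet_sum N z) IHN.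
rewrite (expr2 (sin (pi * z))) (mulrA (dirichlet N z)) dirichlet_sin.
set t := pi * z.
have -> : (2 * N%:R + 1) * t = N%:R * t + (N%:R * t + t) by ring.
have -> : N.+1%:R * t = N%:R * t + t by rewrite -(@natr1 _ N); ring.
rewrite !sinD !cosD.
have := cos2Dsin2 t.
set S := sin _; set C := cos _; set s := sin _; set c := cos _.
move=> h; apply/eqP; rewrite -subr_eq0; apply/eqP.
transitivity (s ^+ 2 * (1 - (C ^+ 2 + S ^+ 2))); first by ring.
by rewrite h subrr mulr0.
Qed.

(** Where sin (pi z) vanishes every cosine of the kernel equals 1. *)
Lemma dirichlet_sum_ge0 N z : 0 <= dirichlet_sum N z.
Proof.
have [s0|s0] := eqVneq (sin (pi * z)) 0; last first.
  have : 0 < sin (pi * z) ^+ 2 by rewrite exprn_even_gt0.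
  by move/pmulr_lge0 <-; rewrite dirichlet_sum_sin sqr_ge0.
have sn n : sin (n%:R * (pi * z)) = 0.
  elim: n => [|n IHn]; first by rewrite mul0r sin0.
  by rewrite -(@natr1 _ n) mulrDl mul1r sinD IHn s0 mul0r mulr0 addr0.
apply: sumr_ge0 => m _; apply: addr_ge0 => //; apply: sumr_ge0 => i _.
have -> : freq i.+1 * z = (i.+1%:R * (pi * z)) *+ 2.
  by rewrite /freq -mulr_natl; ring.
by rewrite cos_mulr2n cos2sin2 sn expr0n/= subr0 mulr2n addrK mulr1.
Qed.

(** Gives the total mass of the kernels without integrating them. *)
Lemma fourier_sum_one N x : fourier_sum (fun=> 1) N x = 1.
Proof.
have s1 : smooth (fun=> 1 : R).
  have E m : (fun=> 1 : R)^`(m)%classic = fun=> (m == 0%N)%:R.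
    elim: m => [//|m IHm]; rewrite derive1nS IHm.
    by apply/funext => y; rewrite derive1_cst.
  by move=> m y; rewrite E; exact: derivable_cst.
have c1 i : cos_coef (fun=> 1) i.+1 = 0 :> R.
  have := sin_coef_deriv i.+1 s1 (fun=> erefl).
  have -> : (fun=> 1 : R)^`() = (fun=> 0 : R).
    by apply/funext => y; rewrite derive1_cst.
  rewrite /sin_coef; under eq_torus_int do rewrite mul0r.
  rewrite torus_int_cst => /esym/eqP; rewrite oppr_eq0 mulf_eq0 => /orP[|/eqP//].
  by rewrite gt_eqF// (lt_le_trans _ (freq_ge _)).
have d1 i : sin_coef (fun=> 1) i.+1 = 0 :> R.
  have := cos_coef_deriv i.+1 s1 (fun=> erefl).
  have -> : (fun=> 1 : R)^`() = (fun=> 0 : R).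
    by apply/funext => y; rewrite derive1_cst.
  rewrite /cos_coef; under eq_torus_int do rewrite mul0r.
  rewrite torus_int_cst => /esym/eqP; rewrite mulf_eq0 => /orP[|/eqP//].
  by rewrite gt_eqF// (lt_le_trans _ (freq_ge _)).
rewrite /fourier_sum big1 => [|i _]; last by rewrite /harmonic_term c1 d1 !mul0r addr0 mulr0.
rewrite addr0 /cos_coef.
under eq_torus_int do rewrite /freq mulr0 mul0r cos0 mulr1.
exact: torus_int_cst.
Qed.

Definition fejer N z : R := N.+1%:R^-1 * dirichlet_sum N.+1 z.

Lemma continuous_fejer N x : continuous (fun y => fejer N (x - y)).
Proof.
apply: continuous_mul; first exact: cst_continuous.
apply: (@continuous_sum _ _ (fun i y => dirichlet i (x - y))) => i.
exact: continuous_dirichlet.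
Qed.

Lemma fourier_mean_fejer v N x : continuous v ->
  arithmetic_mean (fun m => fourier_sum v m x) N =
  torus_int (fun y => v y * fejer N (x - y)).
Proof.
move=> cv.
rewrite /arithmetic_mean/= /series/= big_mkord.
under eq_bigr do rewrite fourier_sum_dirichlet//.
have cD i : continuous (fun y => v y * dirichlet i (x - y)).
  by apply: continuous_mul => //; exact: continuous_dirichlet.
rewrite -(torus_int_sum _ cD) -torus_intZ; last by move=> z; apply: (@continuous_sum _ _ _ cD).
by apply: eq_torus_int => y; rewrite -mulr_sumr mulrCA.
Qed.

(** Write g for |v y - v x| and F for the Fejer kernel at x - y.  Since
    g <= B |sin (pi (x - y))|, the product g^2 F is at most B^2 / (N + 1)
    pointwise, and g F <= (e F + g^2 F / e) / 2.  Integrating over the circle,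
    with F of mass 1, gives the rate without splitting the domain. *)
Lemma fejer_approx v B N e x : continuous v -> 0 < e ->
    (forall x y, `|v x - v y| <= B * `|sin (pi * (x - y))|) ->
  `|arithmetic_mean (fun m => fourier_sum v m x) N - v x| <=
    e / 2 + B ^+ 2 / (2 * e * N.+1%:R).
Proof.
move=> cv e0 vB.
have cF := @continuous_fejer N x.
have F1 : torus_int (fun y => fejer N (x - y)) = 1.
  have := @fourier_mean_fejer (fun=> 1) N x (@cst_continuous _ _ _).
  under [in X in _ = X -> _]eq_torus_int do rewrite mul1r.
  move=> <-; rewrite /arithmetic_mean/= /series/= big_mkord.
  under eq_bigr do rewrite fourier_sum_one.
  by rewrite sumr_const card_ord mulVf// pnatr_eq0.
have cvF : continuous (fun y => v y * fejer N (x - y)) by exact: continuous_mul.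
have cxF : continuous (fun y => v x * fejer N (x - y)).
  by apply: continuous_mul => //; exact: cst_continuous.
have -> : arithmetic_mean (fun m => fourier_sum v m x) N - v x =
    torus_int (fun y => v y * fejer N (x - y) - v x * fejer N (x - y)).
  by rewrite torus_intB// torus_intZ// F1 mulr1 fourier_mean_fejer.
have ceF : continuous (fun y => e / 2 * fejer N (x - y)).
  by apply: continuous_mul => //; exact: cst_continuous.
have -> : e / 2 + B ^+ 2 / (2 * e * N.+1%:R) = torus_int (fun y =>
    e / 2 * fejer N (x - y) + B ^+ 2 / (2 * e * N.+1%:R)).
  rewrite torus_intD//; last exact: cst_continuous.
  by rewrite torus_intZ// F1 mulr1 torus_int_cst.
apply: le_norm_torus_int.
- by move=> y; apply: cvgB; [exact: cvF|exact: cxF].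
- by move=> y; apply: cvgD; [exact: ceF|exact: cvg_cst].
move=> y _; rewrite -mulrBl normrM.
have F0 : 0 <= fejer N (x - y).
  by rewrite mulr_ge0// ?invr_ge0//; exact: dirichlet_sum_ge0.
rewrite (ger0_norm F0).
set g := `|v y - v x|.
have gF : g ^+ 2 * fejer N (x - y) <= B ^+ 2 / N.+1%:R.
  apply: (@le_trans _ _ (B ^+ 2 * sin (pi * (x - y)) ^+ 2 * fejer N (x - y))).
    rewrite ler_wpM2r//; have := vB x y; rewrite distrC -/g => gB.
    rewrite -[sin _ ^+ 2]real_normK ?num_real// -exprMn.
    apply: lerXn2r; rewrite ?nnegrE//; first exact: normr_ge0.
    exact: le_trans (normr_ge0 _) gB.
  rewrite /fejer -mulrA ler_wpM2l ?sqr_ge0//.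
  rewrite mulrCA ger_pMr ?invr_gt0// mulrC dirichlet_sum_sin.
  set t := N.+1%:R * _.
  by have := cos2Dsin2 t; have := sqr_ge0 (cos t); lra.
have N0 : 0 < N.+1%:R :> R by [].
have eN : e != 0 by rewrite gt_eqF.
have -> : B ^+ 2 / (2 * e * N.+1%:R) = (B ^+ 2 / N.+1%:R) / (2 * e).
  by rewrite !invfM; ring.
move: (B ^+ 2 / N.+1%:R) gF => B2 gF.
have : 0 <= (g - e) ^+ 2 * fejer N (x - y) by rewrite mulr_ge0// sqr_ge0.
move=> h; rewrite -(ler_pM2l (mulr_gt0 (ltr0Sn _ 1) e0)).
have -> : 2 * e * (e / 2 * fejer N (x - y) + B2 / (2 * e)) =
  e ^+ 2 * fejer N (x - y) + B2 by field.
nra.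
Qed.

End Fejer.

(** * Series with quadratically decaying terms *)

Section QuadraticDecay.
Context {R : realType}.
Implicit Types (b : nat -> R) (C : R) (N M : nat).

(** Telescoping: C / (n + 1)^2 <= C / n - C / (n + 1). *)
Lemma quadratic_tail b C N M : (forall i, i.+1%:R ^+ 2 * `|b i| <= C) ->
  (0 < N <= M)%N -> `|\sum_(i < M) b i - \sum_(i < N) b i| <= C / N%:R.
Proof.
move=> bC /andP[N0 NM].
have C0 : 0 <= C by apply: le_trans (bC 0%N); rewrite mulr_ge0.
suff : `|\sum_(i < M) b i - \sum_(i < N) b i| <= C / N%:R - C / M%:R.
  move=> /le_trans; apply; rewrite gerBl//; exact: divr_ge0.
rewrite -(subnKC NM); elim: (M - N)%N => [|d IHd].
  by rewrite addn0 !subrr normr0.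
rewrite addnS big_ord_recr/= addrAC.
apply: le_trans (ler_normD _ _) _.
apply: le_trans (lerD IHd (lexx _)) _.
set k := (N + d)%N.
have k0 : 0 < k%:R :> R by rewrite ltr0n /k addn_gt0 N0.
have := bC k; rewrite -(@natr1 _ k) => bk.
have k1 : 0 < (k%:R + 1) ^+ 2 :> R by rewrite exprn_gt0// addr_gt0.
have : `|b k| <= C / (k%:R + 1) ^+ 2 by rewrite ler_pdivlMr// mulrC.
move=> /le_trans h; rewrite -lerBrDl.
have -> : C / N%:R - C / (k%:R + 1) - (C / N%:R - C / k%:R) =
          C * (k%:R^-1 - (k%:R + 1)^-1) by ring.
apply: h; rewrite ler_wpM2l//.
have -> : k%:R^-1 - (k%:R + 1)^-1 = (k%:R * (k%:R + 1))^-1 :> R.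
  field; rewrite !gt_eqF//; lra.
by rewrite lef_pV2 ?posrE ?mulr_gt0//; lra.
Qed.

Lemma quadratic_cvg b C : (forall i, i.+1%:R ^+ 2 * `|b i| <= C) ->
  cvgn (fun N => \sum_(i < N) b i).
Proof.
move=> bC.
have -> : (fun N => \sum_(i < N) b i) = series b.
  by apply/funext => N; rewrite /series/= big_mkord.
apply: normed_cvg; apply: nondecreasing_is_cvgn.
  by apply/nondecreasing_seqP => n; rewrite /= !seriesEnat/= big_nat_recr//= lerDl.
exists (`|b 0%N| + C) => _ [N _ <-] /=; rewrite seriesEnat/= big_mkord.
have C0 : 0 <= C by apply: le_trans (bC 0%N); rewrite mulr_ge0.
case: N => [|N]; first by rewrite big_ord0 addr_ge0.
have := @quadratic_tail (fun i => `|b i|) C 1 N.+1.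
rewrite big_ord1 divr1 => h.
rewrite -lerBlDl; apply: le_trans (ler_norm _) (h _ _) => // i.
by rewrite normr_id.
Qed.

Lemma quadratic_lim_tail b C l N : (forall i, i.+1%:R ^+ 2 * `|b i| <= C) ->
  (fun N => \sum_(i < N) b i) @ \oo --> l ->
  `|l - \sum_(i < N.+1) b i| <= C / N.+1%:R.
Proof.
move=> bC bl.
have : (fun M => `|\sum_(i < M) b i - \sum_(i < N.+1) b i|) @ \oo -->
       `|l - \sum_(i < N.+1) b i|.
  by apply: cvg_norm; apply: cvgB => //; exact: cvg_cst.
move=> /cvgr_to_le; apply; near=> M.
apply: quadratic_tail => //=; near: M; exact: nbhs_infty_ge.
Unshelve. all: by end_near. Qed.

End QuadraticDecay.

(** * Fourier inversion and the Parseval inequality *)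

Section Inversion.
Context {R : realType}.
Implicit Types (v w : R -> R) (a b c e x y z B : R) (n N m : nat).

Lemma harmonic_term_decay v : smooth v -> periodic1 v ->
  exists2 B, 0 <= B & forall n x, n%:R ^+ 4 * `|harmonic_term v n x| <= B.
Proof.
move=> sv pv; have [B B0 dec] := coef_decay sv pv.
exists (B + B); first exact: addr_ge0.
move=> n x; have [cB sB] := dec n; have n4 : 0 <= n%:R ^+ 4 :> R by [].
apply: le_trans (lerD cB sB); rewrite -mulrDr ler_wpM2l//.
apply: le_trans (ler_normD _ _) _; rewrite !normrM; apply: lerD.
  by rewrite ler_piMr// cos_max.
by rewrite ler_piMr// sin_max.
Qed.

Lemma harmonic_term_quadratic v : smooth v -> periodic1 v ->
  exists2 B, 0 <= B & forall n x,
    n.+1%:R ^+ 2 * `|2 * harmonic_term v n.+1 x| <= B.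
Proof.
move=> sv pv; have [B B0 dec] := harmonic_term_decay sv pv.
exists (2 * B); first exact: mulr_ge0.
move=> n x; rewrite normrM ger0_norm// mulrCA ler_wpM2l//.
apply: le_trans (dec n.+1 x); rewrite ler_wpM2r// ler_weXn2l//.
by rewrite ler1n.
Qed.

Lemma fourier_mean_cvg v x : smooth v -> periodic1 v ->
  arithmetic_mean (fun m => fourier_sum v m x) @ \oo --> v x.
Proof.
move=> sv pv; have [B B0 vB] := smooth_lipschitz_sin sv pv.
apply/cvgrPdist_le => e e0; near=> N.
rewrite distrC; apply: le_trans (@fejer_approx R v B N e x _ e0 vB) _.
  exact: smooth_continuous.
have BN : B ^+ 2 / e ^+ 2 <= N%:R by near: N; exact: nbhs_infty_ger.
have N0 : 0 < N.+1%:R :> R by [].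
have {}BN : B ^+ 2 <= N.+1%:R * e ^+ 2.
  by rewrite -ler_pdivrMr ?exprn_gt0// (le_trans BN)// ler_nat.
move: (N.+1%:R) N0 BN => K K0 BK.
rewrite -lerBrDl ler_pdivrMr ?mulr_gt0//.
by apply: le_trans BK _; rewrite le_eqVlt; apply/orP; left; apply/eqP; field.
Unshelve. all: by end_near. Qed.

(** The partial sums converge by decay of the coefficients, so by Cesaro they
    have the same limit as their Fejer means. *)
Lemma fourier_inversion v x : smooth v -> periodic1 v ->
  (fun N => fourier_sum v N x) @ \oo --> v x.
Proof.
move=> sv pv; have [B B0 vB] := harmonic_term_quadratic sv pv.
have cS : cvgn (fun N => fourier_sum v N x).
  apply: is_cvgD; first exact: is_cvg_cst.
  by apply: (@quadratic_cvg _ (fun i => 2 * harmonic_term v i.+1 x) B) => i; exact: vB.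
have := @fourier_mean_cvg v x sv pv; have /cesaro h := cS.
by move=> /(cvg_unique _ h) <-.
Qed.

Lemma fourier_sum_tail v : smooth v -> periodic1 v ->
  exists2 B, 0 <= B & forall N x, `|v x - fourier_sum v N.+1 x| <= B / N.+1%:R.
Proof.
move=> sv pv; have [B B0 vB] := harmonic_term_quadratic sv pv.
exists B => // N x; rewrite opprD addrA.
apply: (@quadratic_lim_tail _ (fun i => 2 * harmonic_term v i.+1 x)) => [i|].
  exact: vB.
have -> : (fun N => \sum_(i < N) 2 * harmonic_term v i.+1 x) =
          (fun N => fourier_sum v N x - cos_coef v 0).
  by apply/funext => M; rewrite /fourier_sum addrAC subrr add0r.
by apply: cvgB; [exact: fourier_inversion|exact: cvg_cst].
Qed.

Definition mode_energy v n : R := cos_coef v n ^+ 2 + sin_coef v n ^+ 2.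

Lemma torus_int_fourier_sum v N : continuous v ->
  torus_int (fun x => v x * fourier_sum v N x) =
  cos_coef v 0 ^+ 2 + \sum_(i < N) 2 * mode_energy v i.+1.
Proof.
move=> cv.
have cc a : continuous (fun y => v y * cos (a * y)).
  by apply: continuous_mul => //; exact: continuous_cosM.
have cs a : continuous (fun y => v y * sin (a * y)).
  by apply: continuous_mul => //; exact: continuous_sinM.
have cZ a w : continuous w -> continuous (fun y => a * w y).
  by move=> cw; apply: continuous_mul => //; exact: cst_continuous.
pose F i y := 2 * cos_coef v i.+1 * (v y * cos (freq i.+1 * y)) +
              2 * sin_coef v i.+1 * (v y * sin (freq i.+1 * y)).
have cF i : continuous (F i).
  by move=> y; apply: cvgD; [exact: (cZ _ _ (cc _))|exact: (cZ _ _ (cs _))].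
rewrite -(eq_torus_int (v := fun y =>
    cos_coef v 0 * (v y * cos (freq 0 * y)) + \sum_(i < N) F i y)).
  rewrite torus_intD; [|exact: (cZ _ _ (cc _))|exact: continuous_sum].
  rewrite torus_intZ// -expr2; congr (_ + _).
  rewrite torus_int_sum//; apply: eq_bigr => i _.
  rewrite torus_intD; [|exact: (cZ _ _ (cc _))|exact: (cZ _ _ (cs _))].
  by rewrite !torus_intZ// /mode_energy -/(cos_coef _ _) -/(sin_coef _ _); ring.
move=> y; rewrite /freq mulr0 mul0r cos0 mulr1 [RHS]mulrDr mulrC.
congr (_ + _); rewrite mulr_sumr; apply: eq_bigr => i _.
by rewrite /F /harmonic_term; ring.
Qed.

Lemma continuous_fourier_sum v N : continuous (fourier_sum v N).
Proof.
move=> y; apply: cvgD; first exact: cvg_cst.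
apply: (@continuous_sum _ N (fun i y => 2 * harmonic_term v i.+1 y)) => i z.
apply: cvgM; first exact: cvg_cst.
apply: cvgD; apply: cvgM; try exact: cvg_cst.
  exact: continuous_cosM.
exact: continuous_sinM.
Qed.

(** Integrating v against its partial sums produces the energies by linearity,
    without orthogonality of the modes; the uniform rate of inversion controls
    the rest. *)
Lemma parseval_le v : smooth v -> periodic1 v ->
  exists2 B, 0 <= B & forall N, torus_int (fun x => v x ^+ 2) <=
    cos_coef v 0 ^+ 2 + \sum_(i < N.+1) 2 * mode_energy v i.+1 + B / N.+1%:R.
Proof.
move=> sv pv; have cv := smooth_continuous sv.
have [A A0 vA] := periodic_bounded cv pv.
have [B B0 vB] := fourier_sum_tail sv pv.
exists (A * B); first exact: mulr_ge0.
move=> N; rewrite -torus_int_fourier_sum//.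
have cS : continuous (fun x => v x * fourier_sum v N.+1 x).
  by apply: continuous_mul => //; exact: continuous_fourier_sum.
rewrite -[X in _ + X]torus_int_cst -torus_intD//; last exact: cst_continuous.
apply: le_torus_int => [||x _].
- exact: continuous_mul.
- by move=> x; apply: cvgD; [exact: cS|exact: cvg_cst].
rewrite -lerBlDl expr2 -mulrBr -mulrA; apply: le_trans (ler_norm _) _.
by rewrite normrM; exact: ler_pM.
Qed.

End Inversion.

(** * Translations and increments *)

Section Translation.
Context {R : realType}.
Implicit Types (v w : R -> R) (a b c e h x y z B : R) (n N m : nat).
Local Notation mu := (@lebesgue_measure R).

Lemma Rintegral_chasles v a b c : continuous v -> a <= c <= b ->
  \int[mu]_(x in `[a, b]) v x =
  \int[mu]_(x in `[a, c]) v x + \int[mu]_(x in `[c, b]) v x.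
Proof.
move=> cv /andP[ac cb].
have := @Rintegral_itvB _ v (BLeft a) (BRight b) c.
move=> /(_ (continuous_itv_integrable _ _ cv)); rewrite !bnd_simp.
move=> /(_ ac cb) h; apply/eqP; rewrite addrC -subr_eq h; apply/eqP.
apply: Rintegral_itv_obnd_cbnd.
apply: integrableS (continuous_itv_integrable c b cv) => //.
by apply: subset_itvr; rewrite bnd_simp.
Qed.

Lemma is_derive_shiftr h x : is_derive x 1 (fun y : R => y + h) 1.
Proof. by apply: is_derive_eq; rewrite addr0. Qed.

Lemma Rintegral_shift v a b h : continuous v -> a <= b ->
  \int[mu]_(x in `[a + h, b + h]) v x = \int[mu]_(x in `[a, b]) v (x + h).
Proof.
move=> cv ab; rewrite /Rintegral; congr fine.
have d1 : (fun x : R => x + h)^`() = fun=> 1.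
  by apply/funext => x; rewrite derive1E; apply: derive_val; exact: is_derive_shiftr.
have dF x : derivable (fun x : R => x + h) x 1.
  by have := is_derive_shiftr h x; case.
rewrite (@integration_by_substitution_increasing R (fun x => x + h) v a b ab).
- by rewrite d1; apply: eq_integral => x _; rewrite fctE/= mulr1.
- by move=> x y _ _; rewrite ltrD2r.
- by rewrite d1 => x _; exact: cst_continuous.
- by rewrite d1; exact: is_cvg_cst.
- by rewrite d1; exact: is_cvg_cst.
- have cF := derivable_continuous dF.
  split=> [x _||]; first exact: dF.
  + by apply: cvg_at_right_filter; exact: cF.
  + by apply: cvg_at_left_filter; exact: cF.
- exact: continuous_subspaceT.
Qed.

Lemma continuous_shiftr v h : continuous v -> continuous (fun x => v (x + h)).
Proof.
move=> cv x; apply: (@continuous_comp _ _ _ (fun x => x + h) v); last exact: cv.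
by apply: cvgD; [exact: cvg_id|exact: cvg_cst].
Qed.

(** The two pieces of [h, 1 + h] on either side of 1 are exchanged by
    periodicity. *)
Lemma torus_int_shift v h : continuous v -> periodic1 v -> 0 <= h <= 1 ->
  torus_int (fun x => v (x + h)) = torus_int v.
Proof.
move=> cv pv /andP[h0 h1].
rewrite /torus_int -Rintegral_shift//.
rewrite (@Rintegral_chasles v (0 + h) (1 + h) 1)//; last lra.
rewrite [RHS](@Rintegral_chasles v 0 1 h)//; last lra.
rewrite add0r addrC (addrC 1) -[X in `[X, h + 1]]add0r Rintegral_shift//.
by congr (_ + _); apply: eq_Rintegral => x _; rewrite pv.
Qed.

Lemma periodic_cos_freq n h : periodic1 (fun x => cos (freq n * (x + h))).
Proof.
move=> x; have -> : freq n * (x + 1 + h) = freq n * (x + h) + freq n by ring.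
by rewrite cosD cos_freq sin_freq mulr1 mulr0 subr0.
Qed.

Lemma periodic_sin_freq n h : periodic1 (fun x => sin (freq n * (x + h))).
Proof.
move=> x; have -> : freq n * (x + 1 + h) = freq n * (x + h) + freq n by ring.
by rewrite sinD cos_freq sin_freq mulr1 mulr0 addr0.
Qed.

Definition increment v h x : R := v (x + h) - v x.

Lemma continuous_increment v h : continuous v -> continuous (increment v h).
Proof.
by move=> cv x; apply: cvgB; [exact: (@continuous_shiftr v h cv)|exact: cv].
Qed.

Lemma increment_derive1n v h m : smooth v ->
  (increment v h)^`(m)%classic = increment (v^`(m)%classic) h.
Proof.
move=> sv; elim: m => [//|m IHm].
rewrite !derive1nS IHm; apply/funext => x.
have dv y : is_derive y 1 (v^`(m)%classic) (v^`(m)^`()%classic y).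
  by rewrite derive1E; apply/derivableP; exact: sv.
rewrite derive1E; apply: derive_val.
apply: is_deriveB.
have dh := is_derive_shiftr h x.
apply: (is_derive_eq (@is_derive1_comp _ (v^`(m)%classic) (fun y => y + h) x _ _ (dv _) dh)).
by rewrite mulr1.
Qed.

Lemma smooth_increment v h : smooth v -> smooth (increment v h).
Proof.
move=> sv m x; rewrite increment_derive1n//.
apply: derivableB; last exact: sv.
have := @is_derive1_comp _ (v^`(m)%classic) (fun y => y + h) x _ _
  (@derivableP _ _ _ _ _ _ (sv m (x + h))) (is_derive_shiftr h x).
by case.
Qed.

Lemma periodic_increment v h : periodic1 v -> periodic1 (increment v h).
Proof. by move=> pv x; rewrite /increment addrAC !pv. Qed.

(** The factor is |e^(2 i pi n h) - 1|^2. *)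
Lemma mode_energy_increment v n h : continuous v -> periodic1 v -> 0 <= h <= 1 ->
  mode_energy (increment v h) n = 2 * (1 - cos (freq n * h)) * mode_energy v n.
Proof.
move=> cv pv h01.
have cc : continuous (fun y => v y * cos (freq n * y)).
  by apply: continuous_mul => //; exact: continuous_cosM.
have cs : continuous (fun y => v y * sin (freq n * y)).
  by apply: continuous_mul => //; exact: continuous_sinM.
have cvh := @continuous_shiftr v h cv.
have cZ a w : continuous w -> continuous (fun y => a * w y).
  by move=> cw; apply: continuous_mul => //; exact: cst_continuous.
have ccB : continuous (fun y => cos (freq n * (y + - h))).
  by apply: (@continuous_shiftr (fun y => cos (freq n * y))); exact: continuous_cosM.
have csB : continuous (fun y => sin (freq n * (y + - h))).
  by apply: (@continuous_shiftr (fun y => sin (freq n * y))); exact: continuous_sinM.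
set C := cos (freq n * h); set S := sin (freq n * h).
have cE : cos_coef (increment v h) n =
    C * cos_coef v n + S * sin_coef v n - cos_coef v n.
  rewrite /cos_coef.
  rewrite -(eq_torus_int (v := fun x => v (x + h) * cos (freq n * x) -
    v x * cos (freq n * x))); last by move=> x; rewrite mulrBl.
  rewrite torus_intB//; last by apply: continuous_mul => //; exact: continuous_cosM.
  congr (_ - _).
  have := @torus_int_shift (fun x => v x * cos (freq n * (x + - h))) h.
  rewrite (_ : torus_int _ = torus_int (fun x => v (x + h) * cos (freq n * x))); last first.
    by apply: eq_torus_int => x; rewrite addrK.
  move=> ->//.
  - rewrite -(eq_torus_int (v := fun x => C * (v x * cos (freq n * x)) +
      S * (v x * sin (freq n * x)))).
      by rewrite torus_intD ?torus_intZ//; exact: cZ.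
    by move=> x; rewrite mulrBr cosB /C /S; ring.
  - exact: continuous_mul.
  - by move=> x; rewrite pv; have := periodic_cos_freq n (- h) x; rewrite /= => ->.
have sE : sin_coef (increment v h) n =
    C * sin_coef v n - S * cos_coef v n - sin_coef v n.
  rewrite /sin_coef.
  rewrite -(eq_torus_int (v := fun x => v (x + h) * sin (freq n * x) -
    v x * sin (freq n * x))); last by move=> x; rewrite mulrBl.
  rewrite torus_intB//; last by apply: continuous_mul => //; exact: continuous_sinM.
  congr (_ - _).
  have := @torus_int_shift (fun x => v x * sin (freq n * (x + - h))) h.
  rewrite (_ : torus_int _ = torus_int (fun x => v (x + h) * sin (freq n * x))); last first.
    by apply: eq_torus_int => x; rewrite addrK.
  move=> ->//.
  - rewrite -(eq_torus_int (v := fun x => C * (v x * sin (freq n * x)) -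
      S * (v x * cos (freq n * x)))).
      by rewrite torus_intB ?torus_intZ//; exact: cZ.
    by move=> x; rewrite mulrBr sinB /C /S; ring.
  - exact: continuous_mul.
  - by move=> x; rewrite pv; have := periodic_sin_freq n (- h) x; rewrite /= => ->.
rewrite /mode_energy cE sE.
have := cos2Dsin2 (freq n * h); rewrite -/C -/S => CS.
apply/eqP; rewrite -subr_eq0; apply/eqP.
transitivity ((cos_coef v n ^+ 2 + sin_coef v n ^+ 2) * ((C ^+ 2 + S ^+ 2) - 1)).
  by ring.
by rewrite CS subrr mulr0.
Qed.

Lemma increment_energy_le v h : smooth v -> periodic1 v -> 0 <= h <= 1 ->
  exists2 B, 0 <= B & forall N, torus_int (fun x => (v (x + h) - v x) ^+ 2) <=
    \sum_(i < N.+1) 4 * (1 - cos (freq i.+1 * h)) * mode_energy v i.+1 +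
    B / N.+1%:R.
Proof.
move=> sv pv h01; have cv := smooth_continuous sv.
have [B B0 vB] := parseval_le (@smooth_increment v h sv) (@periodic_increment v h pv).
exists B => // N; apply: le_trans (vB N) _; rewrite lerD2r.
have -> : cos_coef (increment v h) 0 = 0.
  rewrite /cos_coef /freq; under eq_torus_int do rewrite mulr0 mul0r cos0 mulr1.
  rewrite torus_intB//; last exact: continuous_shiftr.
  by rewrite torus_int_shift// subrr.
rewrite expr0n/= add0r; apply: ler_sum => i _.
by rewrite mode_energy_increment// le_eqVlt; apply/orP; left; apply/eqP; ring.
Qed.

End Translation.

(** * The weights n^alpha as integrals of 1 - cos *)

Section SingularIntegral.
Context {R : realType}.
Implicit Types (a b c s x y z : R) (n N m : nat).
Local Notation mu := (@lebesgue_measure R).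

(** In the variable s = ln x, and for c = min (alpha, 2 - alpha), this dominates
    min (1, x^2) times the Levy measure of the fractional Laplacian. *)
Definition two_sided_exp c s : R := expR (- (c * `|s|)).

Lemma continuous_two_sided_exp c : continuous (two_sided_exp c).
Proof.
move=> s; apply: (@continuous_comp _ _ _ (fun s => - (c * `|s|)) expR).
  apply: cvgN; apply: cvgM; first exact: cvg_cst.
  by apply: cvg_norm; exact: cvg_id.
exact: continuous_expR.
Qed.

Lemma integrable_two_sided_exp c : 0 < c ->
  mu.-integrable setT (EFin \o two_sided_exp c).
Proof.
move=> c0; have cE := @continuous_two_sided_exp c.
apply/integrableP; split.
  by apply/measurable_EFinP; exact: continuous_measurable_fun.
under eq_integral do rewrite /= ger0_norm ?expR_ge0//.
rewrite ge0_symfun_integralT//; last 2 first.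
- by move=> x; exact: expR_ge0.
- by move=> x; rewrite /two_sided_exp/= normrN.
rewrite -set_itvcy.
have -> : (\int[mu]_(x in `[0%R, +oo[) (two_sided_exp c x)%:E =
    \int[mu]_(x in `[0%R, +oo[) ((c^-1)%:E * (exponential_pdf c x)%:E))%E.
  apply: eq_integral => x; rewrite inE/= in_itv/= andbT => x0.
  rewrite exponential_pdfE// -EFinM mulKf ?gt_eqF//.
  by rewrite /two_sided_exp ger0_norm// mulNr.
have ie : mu.-integrable `[0%R, +oo[ (EFin \o exponential_pdf c).
  by apply: integrableS (integrable_exponential_pdf c0).
rewrite integralZl//=.
apply: lte_mul_pinfty; rewrite ?lee_fin//.
apply: lte_mul_pinfty; rewrite ?lee_fin ?invr_ge0 ?(ltW c0)//.
have /integrableP[_] := ie.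
by under eq_integral do rewrite /= ger0_norm ?(exponential_pdf_ge0 (ltW c0))//.
Qed.

Lemma one_sub_cos_bound x : 0 <= 1 - cos (2 * pi * x) <= 2 * pi ^+ 2 * Num.min 1 (x ^+ 2).
Proof.
have -> : 2 * pi * x = (pi * x) *+ 2 by rewrite -mulr_natl; ring.
rewrite cos_mulr2n cos2sin2.
have -> : 1 - ((1 - sin (pi * x) ^+ 2) *+ 2 - 1) = 2 * sin (pi * x) ^+ 2 by ring.
have p2 := @pi_ge2 R.
rewrite mulr_ge0 ?sqr_ge0//= -mulrA ler_wpM2l//.
have [x1|x1] := leP 1 (x ^+ 2).
  have := cos2Dsin2 (pi * x); have := sqr_ge0 (cos (pi * x)); nra.
rewrite -exprMn -[leLHS]real_normK ?num_real// -[leRHS]real_normK ?num_real//.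
by rewrite lerXn2r ?nnegrE// norm_sin_le.
Qed.

Section Weight.
Context (alpha : R) (halpha : 1 < alpha < 2).

Let rate := Num.min alpha (2 - alpha).

Let rate_gt0 : 0 < rate.
Proof. by rewrite lt_min; move: halpha => /andP[]; lra. Qed.

Lemma min_sqr_expR_le s :
  Num.min 1 (expR s ^+ 2) * expR (- (alpha * s)) <= two_sided_exp rate s.
Proof.
have e0 := expR_ge0 (- (alpha * s)).
have ra : rate <= alpha by rewrite ge_min lexx.
have r2 : rate <= 2 - alpha by rewrite ge_min lexx orbT.
rewrite /two_sided_exp; have [s0|s0] := leP 0 s.
  apply: le_trans (_ : 1 * expR (- (alpha * s)) <= _).
    by rewrite ler_wpM2r// ge_min lexx.
  by rewrite mul1r (ger0_norm s0) ler_expR lerN2 ler_wpM2r.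
apply: le_trans (_ : expR s ^+ 2 * expR (- (alpha * s)) <= _).
  by rewrite ler_wpM2r// ge_min lexx orbT.
by rewrite (ltr0_norm s0) -expRM_natl -expRD ler_expR; nra.
Qed.

(** With x = e^s this is (1 - cos (2 pi n x)) x^(-1 - alpha) dx; in the
    logarithmic variable dilations become translations, and the singularity at
    x = 0 becomes a decay as s tends to minus infinity. *)
Definition levy_kernel n s : R :=
  (1 - cos (freq n * expR s)) * expR (- (alpha * s)).

Lemma continuous_levy_kernel n : continuous (levy_kernel n).
Proof.
move=> s; apply: cvgM.
  apply: cvgB; first exact: cvg_cst.
  apply: (@continuous_comp _ _ _ expR (fun y => cos (freq n * y))).
    exact: continuous_expR.
  exact: continuous_cosM.
apply: (@continuous_comp _ _ _ (fun s => - (alpha * s)) expR).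
  by apply: cvgN; apply: cvgM; [exact: cvg_cst|exact: cvg_id].
exact: continuous_expR.
Qed.

Lemma levy_kernel_ge0 n s : 0 <= levy_kernel n s.
Proof. by rewrite mulr_ge0 ?expR_ge0// subr_ge0 cos_le1. Qed.

(** The homogeneity of degree alpha of the fractional Laplacian. *)
Lemma levy_kernel_shift n s :
  levy_kernel n.+1 s = n.+1%:R `^ alpha * levy_kernel 1 (s + ln n.+1%:R).
Proof.
rewrite /levy_kernel mulrCA; congr (_ * _).
  by rewrite expRD lnK ?posrE// /freq; congr (1 - cos _); ring.
rewrite /powR gt_eqF// -expRD; congr expR; ring.
Qed.

Lemma integrable_levy_kernel1 : mu.-integrable setT (EFin \o levy_kernel 1).
Proof.
apply: (@le_integrable _ _ _ mu setT measurableT _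
    (fun s => (2 * pi ^+ 2)%:E * (two_sided_exp rate s)%:E)%E).
- apply/measurable_EFinP; apply: continuous_measurable_fun.
  exact: (@continuous_levy_kernel 1).
- move=> s _; rewrite /= lee_fin ger0_norm ?levy_kernel_ge0//.
  have p2 : 0 <= 2 * pi ^+ 2 :> R by rewrite mulr_ge0// sqr_ge0.
  rewrite ger0_norm; last by rewrite mulr_ge0 ?expR_ge0.
  have := @one_sub_cos_bound (expR s) => /andP[_ h].
  rewrite /levy_kernel /freq mulr1.
  apply: le_trans (ler_wpM2r (expR_ge0 _) h) _.
  by rewrite -[leLHS]mulrA ler_wpM2l// min_sqr_expR_le.
- by apply: integrableZl => //; exact: integrable_two_sided_exp.
Qed.

Definition levy_mass : R := \int[mu]_s levy_kernel 1 s.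

Lemma integral_levy_kernel1_shift b :
  (\int[mu]_s (levy_kernel 1 (s + b))%:E = \int[mu]_s (levy_kernel 1 s)%:E)%E.
Proof.
have d1 : (fun x : R => x + b)^`() = fun=> 1.
  by apply/funext => x; rewrite derive1E; apply: derive_val; exact: is_derive_shiftr.
rewrite [RHS](@increasing_ge0_integration_by_substitutionT R (fun x => x + b)).
- by rewrite d1; apply: eq_integral => s _; rewrite fctE/= mulr1.
- by move=> x y; rewrite ltrD2r.
- by rewrite d1; exact: cst_continuous.
- by rewrite d1; exact: is_cvg_cst.
- by rewrite d1; exact: is_cvg_cst.
- by move=> x; have := is_derive_shiftr b x; case.
- exact: cvg_addrr_Ny.
- exact: cvg_addrr.
- exact: continuous_levy_kernel.
- exact: levy_kernel_ge0.
Qed.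

Lemma integrable_levy_kernel1_shift b :
  mu.-integrable setT (EFin \o (fun s => levy_kernel 1 (s + b))).
Proof.
have cs : continuous (fun s => levy_kernel 1 (s + b)).
  exact: (@continuous_shiftr _ _ _ (@continuous_levy_kernel 1)).
apply/integrableP; split.
  by apply/measurable_EFinP; exact: continuous_measurable_fun.
under eq_integral do rewrite /= ger0_norm ?levy_kernel_ge0//.
rewrite integral_levy_kernel1_shift.
have /integrableP[_] := integrable_levy_kernel1.
by under eq_integral do rewrite /= ger0_norm ?levy_kernel_ge0//.
Qed.

Lemma levy_kernelE n : levy_kernel n.+1 =
  (fun s => n.+1%:R `^ alpha * levy_kernel 1 (s + ln n.+1%:R)).
Proof. by apply/funext => s; exact: levy_kernel_shift. Qed.

Lemma integrable_levy_kernel n : mu.-integrable setT (EFin \o levy_kernel n.+1).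
Proof.
rewrite levy_kernelE.
exact: (integrableZl measurableT _ (integrable_levy_kernel1_shift (ln n.+1%:R))).
Qed.

Lemma Rintegral_levy_kernel n :
  \int[mu]_s levy_kernel n.+1 s = n.+1%:R `^ alpha * levy_mass.
Proof.
rewrite levy_kernelE (RintegralZl _ measurableT (integrable_levy_kernel1_shift _)).
by congr (_ * _); rewrite /Rintegral integral_levy_kernel1_shift.
Qed.

(** On 1/4 <= e^s <= 1/2 the cosine is nonpositive, so the kernel is at least
    1. *)
Lemma levy_mass_gt0 : 0 < levy_mass.
Proof.
pose A : set R := `[ln 4^-1, ln 2^-1].
have mA : measurable A by exact: measurable_itv.
have l42 : ln 4^-1 < ln 2^-1 :> R by rewrite ltr_ln ?posrE//; lra.
have lb s : A s -> 1 <= levy_kernel 1 s.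
  rewrite /A/= in_itv/= => /andP[s4 s2].
  have e4 : 4^-1 <= expR s by rewrite -[4^-1]lnK ?posrE// ler_expR.
  have e2 : expR s <= 2^-1 by rewrite -[2^-1]lnK ?posrE// ler_expR.
  have s0 : s <= 0 by apply: le_trans s2 _; apply: ln_le0; lra.
  have c0 : cos (freq 1 * expR s) <= 0.
    rewrite /freq mulr1; have p0 := @pi_gt0 R.
    have -> : 2 * pi * expR s = (2 * pi * expR s - pi / 2) + pi / 2 by ring.
    by rewrite cosDpihalf oppr_le0 sin_ge0_pi//; nra.
  have e1 : 1 <= expR (- (alpha * s)).
    rewrite -expR0 ler_expR; have := halpha => /andP[]; nra.
  rewrite /levy_kernel; nra.
have iG := integrable_levy_kernel1.
have iA : mu.-integrable A (EFin \o levy_kernel 1) by apply: integrableS iG.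
have AT : \int[mu]_(s in A) levy_kernel 1 s <= levy_mass.
  rewrite /levy_mass /Rintegral fine_le ?integrable_fin_num//.
  apply: ge0_subset_integral => //; first exact: (measurable_int mu).
  by move=> s _; rewrite lee_fin levy_kernel_ge0.
apply: lt_le_trans AT.
have i1 : mu.-integrable A (EFin \o (fun=> 1 : R)).
  by apply: continuous_itv_integrable; exact: cst_continuous.
apply: lt_le_trans (@le_Rintegral _ _ _ mu A (fun=> 1) (levy_kernel 1) mA i1 iA lb).
rewrite Rintegral_cst//= mul1r lebesgue_measure_itv/= lte_fin l42.
by rewrite -EFinD subr_gt0.
Qed.

(** Integrate the hypothesis against the Levy measure.  Only finite sums are
    integrated: the error term e absorbs what truncating the series costs. *)
Lemma fractional_weight_lower_bound :
  exists2 c, 0 <= c & forall N (a : nat -> R) e, 0 <= e ->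
    (forall x, 0 < x -> - (e * Num.min 1 (x ^+ 2)) <=
       \sum_(i < N) a i * (1 - cos (freq i.+1 * x))) ->
    - (e * c) <= \sum_(i < N) a i * i.+1%:R `^ alpha.
Proof.
have I0 := levy_mass_gt0.
pose J : R := \int[mu]_s two_sided_exp rate s.
have iB := integrable_two_sided_exp rate_gt0.
have J0 : 0 <= J by apply: Rintegral_ge0 => s _; exact: expR_ge0.
exists (J / levy_mass); first by rewrite divr_ge0// ltW.
move=> N a e e0 ha.
rewrite mulrA -mulNr ler_pdivrMr//.
pose S M s := \sum_(i < M) a i * levy_kernel i.+1 s.
have [iS SE] : mu.-integrable setT (EFin \o S N) /\
    \int[mu]_s S N s = (\sum_(i < N) a i * i.+1%:R `^ alpha) * levy_mass.
  rewrite /S; clear ha; elim: N => [|N [IH1 IH2]].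
    under eq_Rintegral do rewrite big_ord0.
    rewrite big_ord0 mul0r Rintegral_cst// mul0r; split => //.
    have -> : EFin \o (fun s : R => \sum_(i < 0) a i * levy_kernel i.+1 s) = cst 0%E.
      by apply/funext => s/=; rewrite big_ord0.
    exact: integrable0.
  have ia : mu.-integrable setT (EFin \o (fun s => a N * levy_kernel N.+1 s)).
    exact: (integrableZl measurableT _ (integrable_levy_kernel N)).
  have -> : (fun s => \sum_(i < N.+1) a i * levy_kernel i.+1 s) =
      (fun s => \sum_(i < N) a i * levy_kernel i.+1 s + a N * levy_kernel N.+1 s).
    by apply/funext => s; rewrite big_ord_recr.
  split; first exact: (integrableD measurableT IH1 ia).
  rewrite RintegralD// IH2 RintegralZl//; last exact: integrable_levy_kernel.
  by rewrite Rintegral_levy_kernel big_ord_recr/= mulrDl mulrA.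
rewrite -SE -mulNr /J -RintegralZl//.
apply: le_Rintegral => //.
  exact: (integrableZl measurableT _ iB).
move=> s _.
have := ha _ (expR_gt0 s); move=> /(ler_wpM2r (expR_ge0 (- (alpha * s)))).
rewrite mulr_suml => h.
apply: le_trans (_ : - (e * Num.min 1 (expR s ^+ 2)) * expR (- (alpha * s)) <= _).
  by rewrite !mulNr lerN2 -mulrA ler_wpM2l// min_sqr_expR_le.
apply: le_trans h _; rewrite le_eqVlt; apply/orP; left; apply/eqP.
by apply: eq_bigr => i _; rewrite /levy_kernel mulrA.
Qed.

End Weight.
End SingularIntegral.

(** * From integer frequencies to natural ones *)

Section IntegerModes.
Context {R : realType}.
Implicit Types (v w : R -> R) (a b c x y z : R) (n N m : nat).

Lemma fsum_ball (G : int -> R) N :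
  \sum_(n \in [set n : int | (absz n <= N)%N]) G n =
  G 0 + \sum_(i < N) (G (Posz i.+1) + G (Negz i)).
Proof.
pose r : seq int := 0 :: [seq Posz i.+1 | i <- iota 0 N] ++ [seq Negz i | i <- iota 0 N].
have ru : uniq r.
  rewrite /r/= cat_uniq !map_inj_uniq ?iota_uniq//=; last 2 first.
  - by move=> i j [].
  - by move=> i j [].
  rewrite mem_cat negb_or andbT; apply/andP; split.
    by apply/andP; split; apply/mapP => -[].
  by apply/hasPn => _ /mapP[i _ ->]; apply/mapP => -[].
have pinj : injective (fun i => Posz i.+1) by move=> i j [].
have ninj : injective Negz by move=> i j [].
have rE (k : int) : (k \in r) = (absz k <= N)%N.
  rewrite /r inE mem_cat; case: k => [[|k]|k] //=.
    rewrite (mem_map pinj) mem_iota add0n leq0n/=; case: ltnP => //= _.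
    by apply/negP => /mapP[].
  rewrite (mem_map ninj) mem_iota add0n leq0n/=; case: ltnP => //= _.
    by rewrite orbT.
  by rewrite orbF; apply/negP => /mapP[].
have -> : [set n : int | (absz n <= N)%N] = [set` r].
  by apply/seteqP; split => k /=; rewrite rE.
rewrite -fsbig_seq// /r big_cons big_cat !big_map/=; congr (_ + _).
rewrite big_split/=; congr (_ + _).
  by rewrite -[RHS](big_mkord xpredT (fun i => G (Posz i.+1))) /index_iota subn0.
by rewrite -[RHS](big_mkord xpredT (fun i => G (Negz i))) /index_iota subn0.
Qed.

Lemma fourier_Posz v n :
  fourier v (Posz n) = Complex (cos_coef v n) (- sin_coef v n).
Proof. by []. Qed.

Lemma fourier_Negz v n : continuous v ->
  fourier v (Negz n) = Complex (cos_coef v n.+1) (sin_coef v n.+1).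
Proof.
move=> cv; rewrite /fourier; congr Complex.
  by apply: eq_torus_int => x; rewrite NegzE mulrNz mulrN mulNr cosN.
rewrite -mulN1r -torus_intZ.
  apply: eq_torus_int => x; rewrite NegzE mulrNz.
  have -> : 2 * pi * - n.+1%:~R * x = - (freq n.+1 * x) by rewrite mulrN mulNr.
  by rewrite sinN; ring.
by apply: continuous_mul => //; exact: continuous_sinM.
Qed.

Lemma sq_modulus_fourier v (k : int) : continuous v ->
  sq_modulus (fourier v k) = mode_energy v (absz k).
Proof.
move=> cv; case: k => n.
  by rewrite fourier_Posz /sq_modulus/= sqrrN sqr_sqrtr// addr_ge0 ?sqr_ge0.
by rewrite fourier_Negz// /sq_modulus/= sqr_sqrtr// addr_ge0 ?sqr_ge0.
Qed.

Lemma Re_fourier_mode v (k : int) x : continuous v ->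
  complex.Re (fourier v k * fourier_mode k x) = harmonic_term v (absz k) x.
Proof.
move=> cv; case: k => n.
  by rewrite fourier_Posz /= mulNr opprK.
rewrite fourier_Negz// /= /harmonic_term NegzE mulrNz mulrN mulNr cosN sinN.
by rewrite mulrN opprK.
Qed.

Lemma fracLapE a v x : 0 < a -> continuous v ->
  fracLap a v x = lim ((fun N =>
    \sum_(i < N) freq i.+1 `^ a * (2 * harmonic_term v i.+1 x)) @ \oo).
Proof.
move=> a0 cv; rewrite /fracLap; congr (lim (_ @ \oo)).
apply/funext => N; rewrite fsum_ball normr0 mulr0 powR0 ?gt_eqF// mul0r add0r.
apply: eq_bigr => i _.
rewrite !Re_fourier_mode// NegzE mulrNz normrN /= -/(freq _).
have -> : 2 * pi * `|i.+1%:~R| = freq i.+1 :> R by rewrite /freq ger0_norm.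
by ring.
Qed.

End IntegerModes.

(** * Comparison principle for the fractional Laplacian *)

Section FractionalLaplacian.
Context {R : realType}.
Implicit Types (v w : R -> R) (a b c x y z : R) (n N m : nat).

Lemma fracLap_cvg v a x : 1 < a < 2 -> smooth v -> periodic1 v ->
  (fun N => \sum_(i < N) freq i.+1 `^ a * (2 * harmonic_term v i.+1 x)) @ \oo
    --> fracLap a v x.
Proof.
move=> /andP[a1 a2] sv pv.
rewrite fracLapE; [|lra|exact: smooth_continuous].
have [B B0 dec] := harmonic_term_decay sv pv.
apply: (@quadratic_cvg _ (fun i => freq i.+1 `^ a * (2 * harmonic_term v i.+1 x))
  ((2 * pi) ^+ 2 * (2 * B))) => i.
have f1 : 1 <= freq i.+1 :> R.
  by apply: le_trans (freq_ge _); rewrite ler1n.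
have fa : freq i.+1 `^ a <= freq i.+1 ^+ 2 :> R.
  rewrite -powR_mulrn ?freq_ge0//; apply: ler_powR => //; exact: ltW.
rewrite normrM ger0_norm ?powR_ge0// mulrCA.
apply: le_trans (ler_wpM2r _ fa) _; first by rewrite mulr_ge0.
rewrite normrM ger0_norm// /freq exprMn -mulrA.
by rewrite ler_wpM2l ?sqr_ge0// mulrA -exprD mulrCA ler_wpM2l.
Qed.

Lemma harmonic_term_pm v n x z :
  harmonic_term v n (x + z) + harmonic_term v n (x - z) =
  2 * cos (freq n * z) * harmonic_term v n x.
Proof. by rewrite /harmonic_term mulrDr mulrBr cosD cosB sinD sinB; ring. Qed.

(** Replaces min (1, (n z)^2) by n^2 min (1, z^2), at the price of two powers
    of n, which the decay of the coefficients pays for. *)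
Lemma one_sub_cos_freq_bound n z :
  `|1 - cos (freq n.+1 * z)| <=
    n.+1%:R ^+ 2 * (2 * pi ^+ 2 * Num.min 1 (z ^+ 2)).
Proof.
have /andP[h0 h1] := @one_sub_cos_bound R (n.+1%:R * z).
rewrite /freq -mulrA ger0_norm//; apply: le_trans h1 _.
rewrite [leRHS]mulrCA ler_wpM2l ?mulr_ge0 ?sqr_ge0 ?pi_ge0//.
have n1 : 1 <= n.+1%:R ^+ 2 :> R by rewrite exprn_ege1// ler1n.
have ma : Num.min 1 ((n.+1%:R * z) ^+ 2) <= 1 by rewrite ge_min lexx.
have mb : Num.min 1 ((n.+1%:R * z) ^+ 2) <= n.+1%:R ^+ 2 * z ^+ 2.
  by rewrite ge_min exprMn lexx orbT.
by case: (leP 1 (z ^+ 2)) => z1; [rewrite mulr1; exact: le_trans ma n1|exact: mb].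
Qed.

(** The hypothesis says that z = 0 maximizes v (x + z) - v (y + z), so minus
    half of its symmetric second difference at 0 is nonnegative.  The partial
    sums of the Fourier series of that quantity, with coefficients d below, are
    then at least - C min (1, z^2) / N, and [fractional_weight_lower_bound]
    turns this into a lower bound tending to 0 for the partial sums of the
    difference of fractional Laplacians. *)
Lemma fracLap_le v a x y : 1 < a < 2 -> smooth v -> periodic1 v ->
  (forall z, v (x + z) - v (y + z) <= v x - v y) ->
  fracLap a v y <= fracLap a v x.
Proof.
move=> ha sv pv vxy.
have mid (p q r : R) : q <= p -> r <= p -> 0 <= p - 2^-1 * (q + r) by lra.
have fin (p q r : R) : 0 <= p -> p - q <= r -> - r <= q by lra.
have [B B0 dec] := harmonic_term_decay sv pv.
have [c c0 weight] := fractional_weight_lower_bound ha.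
pose d i := 2 * harmonic_term v i.+1 x - 2 * harmonic_term v i.+1 y.
pose C : R := 2 * B * 2 * (2 * pi ^+ 2).
have C0 : 0 <= C by rewrite !mulr_ge0 ?pi_ge0.
have dB i : i.+1%:R ^+ 4 * `|d i| <= 2 * B * 2.
  have /(_ x) hx := dec i.+1; have /(_ y) hy := dec i.+1.
  have n4 : 0 <= i.+1%:R ^+ 4 :> R by [].
  have : `|d i| <= 2 * `|harmonic_term v i.+1 x| + 2 * `|harmonic_term v i.+1 y|.
    by apply: le_trans (ler_normB _ _) _; rewrite !normrM ger0_norm.
  by move=> /(ler_wpM2l n4) /le_trans; apply; lra.
have low N z : 0 < z -> - (C / N.+1%:R * Num.min 1 (z ^+ 2)) <=
    \sum_(i < N.+1) d i * (1 - cos (freq i.+1 * z)).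
  move=> z0.
  pose t i := d i * (1 - cos (freq i.+1 * z)).
  pose l := (v x - v y) - 2^-1 * ((v (x + z) - v (y + z)) + (v (x - z) - v (y - z))).
  have m0 : 0 <= Num.min 1 (z ^+ 2) by rewrite le_min ler01 sqr_ge0.
  have tC i : i.+1%:R ^+ 2 * `|t i| <= C * Num.min 1 (z ^+ 2).
    rewrite normrM mulrA.
    apply: le_trans (ler_wpM2l _ (one_sub_cos_freq_bound i z)) _.
      by rewrite mulr_ge0.
    have -> : i.+1%:R ^+ 2 * `|d i| *
        (i.+1%:R ^+ 2 * (2 * pi ^+ 2 * Num.min 1 (z ^+ 2))) =
        i.+1%:R ^+ 4 * `|d i| * (2 * pi ^+ 2) * Num.min 1 (z ^+ 2) by ring.
    rewrite ler_wpM2r// /C ler_wpM2r// mulr_ge0// sqr_ge0//.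
  have tl : (fun N => \sum_(i < N) t i) @ \oo --> l.
    have -> : (fun N => \sum_(i < N) t i) = (fun N =>
        (fourier_sum v N x - fourier_sum v N y) -
        2^-1 * ((fourier_sum v N (x + z) - fourier_sum v N (y + z)) +
                (fourier_sum v N (x - z) - fourier_sum v N (y - z)))).
      apply/funext; elim=> [|M IHM].
        by rewrite /fourier_sum !big_ord0; ring.
      have fS u : fourier_sum v M.+1 u = fourier_sum v M u + 2 * harmonic_term v M.+1 u.
        by rewrite /fourier_sum big_ord_recr/= addrA.
      rewrite big_ord_recr/= IHM !fS /t /d.
      have hx := harmonic_term_pm v M.+1 x z.
      have hy := harmonic_term_pm v M.+1 y z.
      nra.
    by apply: cvgB; [apply: cvgB|apply: cvgM; [exact: cvg_cst|apply: cvgD; apply: cvgB]];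
      exact: fourier_inversion.
  have l0 : 0 <= l.
    exact: mid (vxy z) (vxy (- z)).
  have := quadratic_lim_tail N tC tl; rewrite ler_norml => /andP[_].
  by move=> /(fin _ _ _ l0); rewrite mulrAC.
pose K := (2 * pi) `^ a * (C * c).
pose D N := \sum_(i < N) freq i.+1 `^ a * (2 * harmonic_term v i.+1 x) -
            \sum_(i < N) freq i.+1 `^ a * (2 * harmonic_term v i.+1 y).
have DE N : D N = (2 * pi) `^ a * \sum_(i < N) d i * i.+1%:R `^ a.
  rewrite /D -sumrB mulr_sumr; apply: eq_bigr => i _.
  by rewrite /freq powRM ?mulr_ge0 ?pi_ge0// /d; ring.
have D0 N : 0 <= D N.+1 + K * N.+1%:R^-1.
  have := weight N.+1 d (C / N.+1%:R) (divr_ge0 C0 (ler0n _ _)) (low N).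
  move=> /(ler_wpM2l (powR_ge0 (2 * pi) a)); rewrite -DE.
  rewrite -subr_ge0 mulrN opprK => /le_trans; apply.
  by rewrite lerD2l /K le_eqVlt; apply/orP; left; apply/eqP; ring.
rewrite -subr_ge0.
have Dl : D @ \oo --> fracLap a v x - fracLap a v y.
  by apply: cvgB; exact: fracLap_cvg.
have DKl : (fun N => D N.+1 + K * N.+1%:R^-1) @ \oo -->
    (fracLap a v x - fracLap a v y) + K * 0.
  apply: cvgD; first by rewrite cvg_shiftS.
  by apply: cvgM; [exact: cvg_cst|exact: cvg_harmonic].
rewrite mulr0 addr0 in DKl.
by apply: (cvgr_to_ge DKl); near=> N.
Unshelve. all: by end_near. Qed.

End FractionalLaplacian.

(** * Regularity of solutions *)

Section Regularity.
Context {R : realType}.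
Implicit Types (u : R -> R -> R) (t x y h : R) (m : nat).

Lemma smooth_halfplane_dx u : smooth_halfplane u -> smooth_halfplane (dx u).
Proof. by move=> su m; have [_ []] := su m.+1. Qed.

Lemma smooth_slice u t : smooth_halfplane u -> 0 <= t -> smooth (u t).
Proof.
move=> su t0 m; elim: m u su => [|m IHm] u su x.
  by have [_ [_ du _ _]] := su 1%N; exact: du.
by rewrite derive1Sn; exact: IHm (smooth_halfplane_dx su) x.
Qed.

Lemma dt_cvg u t x : smooth_halfplane u -> 0 <= t ->
  dt_quotient u t x @ dt_filter t --> dt u t x.
Proof. by move=> su t0; have [_ [du _ _ _]] := su 1%N; exact: du. Qed.

(** Extending u to negative times by its initial value gives a function that is
    continuous on the whole plane, so that relative topologies do not appear in
    the compactness and integration arguments. *)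
Lemma halfplane_continuous u : smooth_halfplane u ->
  continuous (fun p : R * R => u (Num.max 0 p.1) p.2).
Proof.
move=> su p; have [/subspace_continuousP cu _] := su 0%N.
have p0 : 0 <= Num.max 0 p.1 by rewrite le_max lexx.
have cu' := cu (Num.max 0 p.1, p.2) p0.
have cmax : (fun q : R * R => (Num.max 0 q.1, q.2)) @ p --> (Num.max 0 p.1, p.2).
  have c1 : (fun q : R * R => Num.max 0 q.1) @ p --> Num.max 0 p.1.
    apply: (@continuous_max R _ (fun=> 0) (fun q : R * R => q.1)).
      exact: cst_continuous.
    exact: cvg_fst.
  have c2 : (fun q : R * R => q.2) @ p --> p.2 by exact: cvg_snd.
  exact: (cvg_pair c1 c2).
move=> B nB; have H := cmax _ (cu' B nB).
suff : nbhs p (fun q : R * R => B (u (Num.max 0 q.1) q.2)) by [].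
move: H; rewrite /= => H.
refine (@filterS _ (nbhs p) (nbhs_filter p) _ _ _ H).
by move=> q /= Hq; apply: Hq; rewrite le_max lexx.
Qed.

End Regularity.

(** * The one-sided Lipschitz bound *)

Section MaximumPrinciple.
Context {R : realType}.
Implicit Types (u : R -> R -> R) (t x y h : R).

(** Earlier times only: the difference quotients for small negative steps are
    nonnegative. *)
Lemma dt_diff_ge0 u t x y : smooth_halfplane u -> 0 < t ->
  (forall s, 0 <= s <= t -> u s x - u s y <= u t x - u t y) ->
  dt u t y <= dt u t x.
Proof.
move=> su t0 ut; rewrite -subr_ge0.
(* Negative steps h with - t <= h are admissible in the one-sided filter. *)
have sub : (0 : R)^'- `=>` dt_filter t.
  move=> B tB; have n0 : \forall h \near (0 : R), 0 <= t + h.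
    apply/nbhs_ballP; exists t => //= h; rewrite /ball/= sub0r normrN.
    by rewrite ltr_norml => /andP[]; lra.
  move: (tB : nbhs (0:R) (fun h => h != 0 -> 0 <= t + h -> B h)).
  apply: filterS2 n0 => h th tB' h0; apply: tB' => //.
  by rewrite lt_eqF.
have dc z : dt_quotient u t z @ (0:R)^'- --> dt u t z.
  exact: cvg_trans (cvg_app _ sub) (@dt_cvg _ u t z su (ltW t0)).
apply: (cvgr_to_ge (cvgB (dc x) (dc y))).
near=> h.
have h0 : h < 0 by near: h; exact: nbhs_left_lt.
have th : 0 <= t + h by rewrite -lerBlDl sub0r; near: h; apply: nbhs_left_ge; lra.
have := ut (t + h); rewrite th /= gerDl (ltW h0) => /(_ isT) hh.
have D0 : u (t + h) x - u t x - (u (t + h) y - u t y) <= 0.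
  by move: hh; rewrite -subr_le0; congr (_ <= _); ring.
suff : 0 <= h^-1 * (u (t + h) x - u t x) - h^-1 * (u (t + h) y - u t y) by [].
rewrite -mulrBr.
by rewrite mulr_le0// invr_le0 ltW.
Unshelve. all: by end_near. Qed.

Lemma derive1_eq0_at_max (g : R -> R) a b c : a < c < b ->
  (forall x, derivable g x 1) -> (forall x, a < x < b -> g x <= g c) ->
  g^`() c = 0.
Proof.
move=> /andP[ac cb] dg gc.
have := @derive1_at_max R g a b c (ltW (lt_trans ac cb)) (fun x _ => dg x).
rewrite in_itv/= ac cb => /(_ isT) H.
rewrite derive1E; apply: derive_val; apply: H => x; rewrite in_itv/=; exact: gc.
Qed.

Lemma flux_deriv_lt sigma (f : R -> R) x y : flux sigma f -> x < y ->
  f^`() x < f^`() y.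
Proof.
move=> [sf s0 f2 _] xy; rewrite -subr_gt0.
have [c _ ->] := @derivable_MVT R f^`() x y (sf 1%N) (ltW xy).
by rewrite mulr_gt0 ?subr_gt0// (lt_le_trans s0)//; exact: f2.
Qed.

(** Doubling of variables: at a positive maximum of
    u(t, y + h) - u(t, y) - L h over [0, T] x R x [0, 1], the step h is interior
    (the expression is nonpositive at h = 0 and h = 1), t is positive (by the
    bound on u0), both slopes are L, and the two equations contradict the sign
    of the time derivative. *)
Lemma one_sided_lipschitz alpha sigma f nu (u0 : R -> R) u (L : R) :
    1 < alpha < 2 -> flux sigma f -> 0 < nu -> solution alpha f nu u0 u ->
    smooth u0 -> 0 < L -> (forall x, u0^`() x <= L) ->
  forall t y h, 0 <= t -> 0 <= h <= 1 -> u t (y + h) - u t y <= L * h.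
Proof.
move=> ha hf nu0 [su pu _ u0E eqn] su0 L0 u0L T y0 h0 T0 h01.
have aux (a b c d e : R) : a - e - c <= b - e - d -> a - c <= b - d by lra.
rewrite leNgt; apply/negP => bad.
pose Phi (p : R * (R * R)) : R :=
  u (Num.max 0 p.1) (p.2.1 + p.2.2) - u (Num.max 0 p.1) p.2.1 - L * p.2.2.
have cPhi : continuous Phi.
  have cu := halfplane_continuous su.
  have c1 : continuous (fun p : R * (R * R) => p.1) by move=> p; exact: cvg_fst.
  have c2 : continuous (fun p : R * (R * R) => p.2.1).
    by move=> p; apply: (@continuous_comp _ _ _ snd fst); [exact: cvg_snd|exact: cvg_fst].
  have c3 : continuous (fun p : R * (R * R) => p.2.2).
    by move=> p; apply: (@continuous_comp _ _ _ snd snd); [exact: cvg_snd|exact: cvg_snd].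
  have c23 : continuous (fun p : R * (R * R) => p.2.1 + p.2.2).
    by move=> p; apply: cvgD; [exact: c2|exact: c3].
  have cp (g : R * (R * R) -> R) : continuous g ->
      continuous (fun p : R * (R * R) => u (Num.max 0 p.1) (g p)).
    move=> cg p.
    apply: (@continuous_comp _ _ _ (fun p : R * (R * R) => (p.1, g p))
      (fun p : R * R => u (Num.max 0 p.1) p.2)); last exact: cu.
    exact: (cvg_pair (c1 p) (cg p)).
  move=> p; apply: cvgB; last by apply: cvgM; [exact: cvg_cst|exact: c3].
  by apply: cvgB; [exact: (cp _ c23)|exact: (cp _ c2)].
pose A : set (R * (R * R)) := `[0, T] `*` (`[0, 1] `*` `[0, 1]).
have cA : compact A.
  by apply: compact_setX; [|apply: compact_setX]; exact: segment_compact.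
have A0 : A !=set0.
  by exists (0, (0, 0)); rewrite /A/= !in_itv/= !lexx ler01 T0.
have [[t [y h]] /set_mem Ac Amax] := compact_EVT_max A0 cA (continuous_subspaceT cPhi).
move: Ac; rewrite /A/= !in_itv/= => -[/andP[t0 tT] [/andP[y0' y1] /andP[h0' h1]]].
(* By periodicity, the maximum is over all base points z. *)
have maxi s z k : 0 <= s <= T -> 0 <= k <= 1 ->
    u s (z + k) - u s z - L * k <= u t (y + h) - u t y - L * h.
  move=> /andP[s0 sT] /andP[k0 k1].
  pose m := (- Num.floor z)%R.
  have z01 : 0 <= z + m%:~R <= 1.
    rewrite mulrNz subr_ge0 floor_le_tmp/= lerBlDl addrC.
    by have := floorD1_gt z; rewrite intrD => /ltW; rewrite addrC.
  have := Amax (s, (z + m%:~R, k)).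
  have -> : Phi (t, (y, h)) = u t (y + h) - u t y - L * h by rewrite /Phi/= max_r.
  have -> : Phi (s, (z + m%:~R, k)) = u s (z + k) - u s z - L * k.
    rewrite /Phi/= max_r//; have -> : z + m%:~R + k = z + k + m%:~R by rewrite addrAC.
    by rewrite !(periodicz _ _ (pu s s0)).
  apply; apply/mem_set; rewrite /A/= !in_itv/= s0 sT z01 k0 k1.
  by [].
have pos : 0 < u t (y + h) - u t y - L * h.
  by apply: lt_le_trans (maxi T y0 h0 _ h01); rewrite ?T0 ?lexx// subr_gt0.
have st : smooth (u t) := smooth_slice su t0.
have hN0 : 0 < h.
  rewrite lt_neqAle h0' andbT; apply/eqP => h_0.
  by move: pos; rewrite -h_0 addr0 mulr0 subrr subr0 ltxx.
have hN1 : h < 1.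
  rewrite lt_neqAle h1 andbT; apply/eqP => h_1.
  by move: pos; rewrite h_1 (pu t t0) subrr sub0r mulr1 oppr_gt0 ltNge (ltW L0).
have tN0 : 0 < t.
  rewrite lt_neqAle t0 andbT; apply/eqP => t_0.
  move: pos; rewrite -t_0 u0E ltNge => /negP; apply.
  have yh : y <= y + h by rewrite lerDl.
  have [c _ ->] := @derivable_MVT R u0 y (y + h) (fun x => @smooth_derivable _ u0 x su0) yh.
  by rewrite addrAC subrr add0r subr_le0 ler_wpM2r.
pose X := y + h.
have duX : (u t)^`() X = L.
  have dg x : is_derive x 1 (fun k => u t (y + k) - L * k) ((u t)^`() (y + x) - L).
    have dc : is_derive x 1 (fun k : R => y + k) 1.
      have -> : (fun k : R => y + k) = (fun k => k + y).
        by apply/funext => k; rewrite addrC.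
      exact: is_derive_shiftr.
    have dL : is_derive x 1 (fun k : R => L * k) L.
      by apply: is_derive_eq; rewrite scaler1.
    have du : is_derive (y + x) 1 (u t) ((u t)^`() (y + x)).
      by rewrite derive1E; apply/derivableP; exact: smooth_derivable.
    have dU := is_derive_eq (@is_derive1_comp _ (u t) (fun k => y + k) x _ _ du dc) (mulr1 _).
    exact: is_deriveB dU dL.
  have := @derive1_eq0_at_max (fun k => u t (y + k) - L * k) 0 1 h.
  have -> : (fun k => u t (y + k) - L * k)^`() h = (u t)^`() (y + h) - L.
    by rewrite derive1E; apply: derive_val; exact: dg.
  rewrite hN0 hN1 => /(_ isT) H.
  apply/eqP; rewrite -subr_eq0; apply/eqP; apply: H => //.
  move=> x /andP[x0 x1]; have := maxi t y x.
  rewrite t0 tT (ltW x0) (ltW x1) => /(_ isT isT).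
  exact: aux.
have duy : (u t)^`() y = L.
  have si : smooth (increment (u t) h) := @smooth_increment _ _ h st.
  have := @derive1_eq0_at_max (increment (u t) h) (y - 1) (y + 1) y.
  rewrite ltrBlDr ltrDl ltr01 => /(_ isT) H.
  have := @increment_derive1n _ (u t) h 1 st.
  move=> /(congr1 (fun g => g y)); rewrite derive1n1 H.
  - by rewrite /increment derive1n1 -/X duX => /esym/eqP; rewrite subr_eq0 => /eqP.
  - by move=> x; exact: smooth_derivable.
  move=> x _; have := maxi t x h; rewrite t0 tT h0' h1 => /(_ isT isT).
  by rewrite lerD2r.
have dtX : dt u t y <= dt u t X.
  apply: dt_diff_ge0 => // s /andP[s0 st'].
  have := maxi s y h; rewrite s0 (le_trans st' tT) h0' h1 => /(_ isT isT).
  by rewrite lerD2r.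
have fl : fracLap alpha (u t) y <= fracLap alpha (u t) X.
  apply: fracLap_le => //; first exact: pu.
  move=> z; have := maxi t (y + z) h; rewrite t0 tT h0' h1 => /(_ isT isT).
  by rewrite lerD2r addrAC.
have dcomp x : derive1 (f \o u t) x = f^`() (u t x) * (u t)^`() x.
  rewrite derive1_comp//; first exact: smooth_derivable.
  by case: hf => sf _ _ _; exact: smooth_derivable.
have eX := eqn t X t0; have ey := eqn t y t0.
move: eX ey; rewrite !dcomp duX duy => eX ey.
have uyX : u t y < u t X.
  by rewrite -subr_gt0; apply: lt_le_trans pos _; rewrite gerBl mulr_ge0 ?ltW.
have := flux_deriv_lt hf uyX.
rewrite -(ltr_pM2r L0) => hL.
have := ler_wpM2l (ltW nu0) fl.
lra.
Qed.

End MaximumPrinciple.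

(** * The essential supremum of a continuous function *)

Section SupNorm.
Context {R : realType}.
Implicit Types (v w : R -> R) (a b c x y z B : R) (n N m : nat).
Local Notation mu := (@torus_measure R).

Lemma torus_measure_itv a b : 0 <= a -> a < b -> b <= 1 ->
  mu `[a, b]%classic = (b - a)%:E.
Proof.
move=> a0 ab b1; rewrite /torus_measure/= /mrestr.
rewrite (_ : _ `&` _ = `[a, b]%classic); last first.
  apply/seteqP; split => x /=; first by case.
  rewrite !in_itv/= => /andP[ax xb]; split; apply/andP; split => //; lra.
by rewrite lebesgue_measure_itv/= lte_fin ab -EFinD.
Qed.

Lemma torus_measureT_gt0 : (0 < mu setT)%E.
Proof.
have : (mu `[0%R, 1%R]%classic <= mu setT)%E by apply: le_measure; rewrite ?inE.
by apply: lt_le_trans; rewrite torus_measure_itv// lte_fin subr_gt0.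
Qed.

Lemma Linfty_normE v :
  Lp_norm +oo%E v = fine (ess_sup mu (abse \o (EFin \o v))).
Proof. by rewrite /Lp_norm unlock torus_measureT_gt0. Qed.

Lemma Linfty_norm_le v B : 0 <= B -> (forall x, `|v x| <= B) ->
  Lp_norm +oo%E v <= B.
Proof.
move=> B0 vB; rewrite Linfty_normE.
have : (ess_sup mu (abse \o (EFin \o v)) <= B%:E)%E.
  by apply/ess_supP; apply: nearW => x; rewrite /= lee_fin.
by case: (ess_sup _ _) => //= r; rewrite lee_fin.
Qed.

(** By continuity a value above the essential supremum would persist on a
    subinterval of [0, 1], which is not negligible. *)
Lemma le_Linfty_norm v x : continuous v -> periodic1 v ->
  `|v x| <= Lp_norm +oo%E v.
Proof.
move=> cv pv; have [B B0 vB] := periodic_bounded cv pv.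
have [y /andP[y0 y1] ->] := periodic_reduce x pv.
rewrite Linfty_normE.
set S := ess_sup _ _.
have SB : (S <= B%:E)%E.
  by apply/ess_supP; apply: nearW => z; rewrite /= lee_fin.
have S0 : (0 <= S)%E by apply: ess_sup_gee torus_measureT_gt0 _; apply: nearW => z /=.
have Sfin : S \is a fin_num by rewrite ge0_fin_numE// (le_lt_trans SB)// ltry.
rewrite leNgt; apply/negP => Sy.
have [N [mN N0 sN]] : {ae mu, forall z, (`|v z|%:E <= S)%E} by exact: ess_sup_ge.
have : \forall z \near y, fine S < `|v z|.
  have cn : (fun z => `|v z|) @ y --> `|v y| by apply: cvg_norm; exact: cv.
  exact: cvgr_gt cn _ Sy.
move=> /nbhs_ballP[e /= e0 he].
(* A length d <= 1/2 fits in [0, 1] on one side of y. *)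
pose d := Num.min (e / 2) 2^-1.
have d0 : 0 < d by rewrite lt_min divr_gt0//= invr_gt0.
have de : d < e by apply: le_lt_trans (_ : e / 2 < e); [rewrite ge_min lexx|lra].
have d2 : d <= 2^-1 by rewrite ge_min lexx orbT.
have [a [b [a0 ab b1 sub]]] : exists a, exists b,
    [/\ 0 <= a, a < b, b <= 1 & forall z, a <= z <= b -> `|y - z| <= d].
  have [y2|y2] := leP y 2^-1.
    exists y, (y + d); split; [lra|lra|lra|].
    move=> z /andP[z1 z2]; rewrite ler_norml; lra.
  exists (y - d), y; split; [lra|lra|lra|].
  move=> z /andP[z1 z2]; rewrite ler_norml; lra.
have : (mu `[a, b]%classic <= mu N)%E.
  apply: le_measure; rewrite ?inE//=.
  move=> z; rewrite /= in_itv/= => zab; apply: sN => /=.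
  apply/negP; rewrite -ltNge -(fineK Sfin) lte_fin; apply: he.
  by rewrite /ball/=; apply: le_lt_trans (sub _ zab) de.
by rewrite torus_measure_itv// [X in (_ <= X)%E]N0 lee_fin leNgt subr_gt0 ab.
Qed.

End SupNorm.

(** * Increments across a cliff *)

Section Cliff.
Context {R : realType}.
Implicit Types (v w : R -> R) (a b c h l x y z B K : R) (n N m : nat).
Local Notation mu := (@lebesgue_measure R).

Lemma torus_int_shift_any v h : continuous v -> periodic1 v ->
  torus_int (fun x => v (x + h)) = torus_int v.
Proof.
move=> cv pv; pose m := (- Num.floor h)%R.
have m01 : 0 <= h + m%:~R <= 1.
  rewrite mulrNz subr_ge0 floor_le_tmp/= lerBlDl addrC.
  by have := floorD1_gt h; rewrite intrD => /ltW; rewrite addrC.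
rewrite -(torus_int_shift cv pv m01); apply: eq_torus_int => x.
by rewrite addrA (periodicz _ _ pv).
Qed.

Lemma torus_int_ge v c l : continuous v -> (forall x, 0 <= v x) ->
  0 <= l <= 1 -> (forall x, 0 <= x <= l -> c <= v x) ->
  c * l <= torus_int v.
Proof.
move=> cv v0 l01 vc; rewrite /torus_int (Rintegral_chasles cv l01).
rewrite -[leLHS]addr0; apply: lerD; last by apply: Rintegral_ge0.
have <- : \int[mu]_(x in `[0, l]) c = c * l.
  rewrite Rintegral_cst//= lebesgue_measure_itv/= lte_fin.
  have [l0|l0] := ltP 0 l; first by rewrite oppr0 adde0.
  by have -> : l = 0 by apply/eqP; rewrite eq_le l0; case/andP: l01.
apply: le_Rintegral => //.
- by apply: continuous_itv_integrable; exact: cst_continuous.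
- exact: continuous_itv_integrable.
Qed.

Lemma MVT_le v B a b : (forall x, derivable v x 1) -> a <= b ->
  (forall x, a <= x <= b -> v^`() x <= B) -> v b - v a <= B * (b - a).
Proof.
move=> dv ab vB; have [c cab ->] := derivable_MVT dv ab.
by rewrite ler_wpM2r ?subr_ge0// vB.
Qed.

(** The windows that see the cliff start in an interval of length l / 2, and
    across each of them v drops by at least K^-3 / 25. *)
Definition cliff_constant K : R := 2^-1 * (25^-1 * K ^- 3) ^+ 2.

(** With r = K^-2 e / 16, the slope stays below - (15/16) (K e)^-1 within r of
    x0, so v drops by (15/128) K^-3 there; outside, v grows by at most
    K l <= K^-3 / 20.  A window [x, x + l] contains that neighbourhood for x
    in an interval of length l / 2, and 15/128 - 1/20 > 1/25. *)
Lemma cliff_increment v K e x0 l : smooth v -> periodic1 v ->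
    1 < K -> 0 < e ->
    (forall x, v^`() x <= K) -> v^`() x0 <= - (K^-1 * e^-1) ->
    (forall x, `|v^`()^`() x| <= K * e ^- 2) ->
    C_1 K * e < l <= C_2 K ->
  cliff_constant K * l <= torus_int (fun x => (v (x + l) - v x) ^+ 2).
Proof.
move=> sv pv K1 e0 vK vx0 v2 /andP[l1 l2].
have K0 : 0 < K by lra.
have sv' := smooth_deriv sv.
have dv x := @smooth_derivable _ v x sv.
have dv' x := @smooth_derivable _ _ x sv'.
set k := K^-1 in vx0 l1 l2 *; set q := e^-1 in vx0 v2 l1 *.
have k0 : 0 < k by rewrite invr_gt0.
have q0 : 0 < q by rewrite invr_gt0.
have kK : k * K = 1 by rewrite mulVf// gt_eqF.
have qe : q * e = 1 by rewrite mulVf// gt_eqF.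
have k1 : k < 1 by rewrite invf_lt1.
have C1E : C_1 K = 4^-1 * k ^+ 2 by rewrite /C_1 exprVn.
have C2E : C_2 K = 20^-1 * k ^+ 4 by rewrite /C_2 exprVn.
have ccE : cliff_constant K = 2^-1 * (25^-1 * k ^+ 3) ^+ 2.
  by rewrite /cliff_constant exprVn.
rewrite C1E in l1; rewrite C2E in l2; rewrite -exprVn -/q in v2.
pose r := 16^-1 * k ^+ 2 * e.
have r0 : 0 < r by rewrite !mulr_gt0// exprn_gt0.
have rl : 4 * r < l by move: l1; rewrite /r; lra.
have l0 : 0 < l by lra.
have l20 : l <= 20^-1.
  by apply: le_trans l2 _; rewrite ler_piMr// exprn_ile1// ltW.
have steep x : x0 - r <= x <= x0 + r -> v^`() x <= - (15 / 16 * (k * q)).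
  move=> /andP[xl xr].
  have := @lipschitz_deriv _ v^`() _ x x0 dv' v2.
  have xr' : `|x - x0| <= r by rewrite ler_norml; lra.
  move=> /(le_trans (ler_norm _)).
  have K2 : 0 <= K * q ^+ 2 by rewrite mulr_ge0 ?exprn_ge0 ?ltW.
  move=> /le_trans /(_ (ler_wpM2l K2 xr')).
  have -> : K * q ^+ 2 * r = 16^-1 * (k * K) * (q * e) * (k * q) by rewrite /r; ring.
  rewrite kK qe !mulr1; lra.
have drop x : x0 - 3 / 4 * l <= x <= x0 - 4^-1 * l ->
    v (x + l) - v x <= - (25^-1 * k ^+ 3).
  move=> /andP[xl xr].
  have vK' a b : a <= b -> v b - v a <= K * (b - a).
    by move=> ab; apply: MVT_le.
  have h1 : v (x0 - r) - v x <= K * (x0 - r - x) by apply: vK'; lra.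
  have h3 : v (x + l) - v (x0 + r) <= K * (x + l - (x0 + r)) by apply: vK'; lra.
  have h2 : v (x0 + r) - v (x0 - r) <=
      - (15 / 16 * (k * q)) * (x0 + r - (x0 - r)) by apply: MVT_le => //; lra.
  have h2E : - (15 / 16 * (k * q)) * (x0 + r - (x0 - r)) = - (15 / 128 * k ^+ 3).
    transitivity (- (15 / 128 * k ^+ 3 * (q * e))); first by rewrite /r; field.
    by rewrite qe mulr1.
  rewrite h2E in h2.
  have Kl : K * l <= 20^-1 * k ^+ 3.
    apply: le_trans (ler_wpM2l (ltW K0) l2) _.
    have -> : K * (20^-1 * k ^+ 4) = 20^-1 * k ^+ 3 * (k * K) by ring.
    by rewrite kK mulr1.
  have Kr : 0 <= K * r by rewrite mulr_ge0 ?ltW.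
  have k3 : 0 <= k ^+ 3 by rewrite exprn_ge0 ?ltW.
  move: h1 h2 h3 Kl Kr k3; rewrite !mulrBr !mulrDr.
  move: (K * l) (K * r) (K * x) (K * x0) (k ^+ 3) (v (x + l)) (v x)
    (v (x0 + r)) (v (x0 - r)) => p1 p2 p3 p4 p5 p6 p7 p8 p9.
  clear; lra.
pose g x := (v (x + l) - v x) ^+ 2.
have cinc : continuous (fun x => v (x + l) - v x).
  exact: (@continuous_increment _ v l (smooth_continuous sv)).
have cg : continuous g.
  by have -> : g = (fun x => (v (x + l) - v x) * (v (x + l) - v x)) by []; apply: continuous_mul.
have pg : periodic1 g by move=> x; rewrite /g addrAC !pv.
rewrite -/g -(@torus_int_shift_any g (x0 - 3 / 4 * l) cg pg).
have -> : cliff_constant K * l = (25^-1 * k ^+ 3) ^+ 2 * (l / 2) by rewrite ccE; ring.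
have k3 : 0 <= 25^-1 * k ^+ 3 by rewrite mulr_ge0// exprn_ge0 ?ltW.
apply: torus_int_ge.
- exact: continuous_shiftr.
- by move=> x; exact: sqr_ge0.
- by clear -l0 l20; lra.
move=> x /andP[x0' xl].
have := drop (x + (x0 - 3 / 4 * l)).
have -> : x0 - 3 / 4 * l <= x + (x0 - 3 / 4 * l) <= x0 - 4^-1 * l.
  by clear -x0' xl; lra.
rewrite /g => /(_ isT) dr.
move: (25^-1 * k ^+ 3) (v _ - v _) k3 dr => p q' p0 dr.
clear -p0 dr; nra.
Qed.

End Cliff.

(** * Energy in a shell at a fixed time *)

Section Spectrum.
Context {R : realType}.
Implicit Types (v w : R -> R) (a b c h l x y z B K L : R) (n N m k M : nat).

Lemma deriv_le_increment v L y : smooth v ->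
  (forall h, 0 <= h <= 1 -> v (y + h) - v y <= L * h) -> v^`() y <= L.
Proof.
move=> sv vL; have dv := @smooth_derivable _ v y sv.
have dc : (fun h => h^-1 *: (v (h *: 1 + y) - v y)) @ (0:R)^' --> v^`() y.
  by rewrite derive1E; exact: dv.
have dr : (fun h => h^-1 *: (v (h *: 1 + y) - v y)) @ (0:R)^'+ --> v^`() y.
  exact: cvg_dnbhs_at_right dc.
apply: (cvgr_to_le dr); near=> h.
have h0 : 0 < h by near: h; exact: nbhs_right_gt.
have h1 : h <= 1 by near: h; exact: nbhs_right_le.
have -> : h *: 1 + y = y + h by rewrite addrC; congr (_ + _); exact: mulr1.
suff : h^-1 * (v (y + h) - v y) <= L by [].
by rewrite ler_pdivrMl// mulrC vL// (ltW h0).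
Unshelve. all: by end_near. Qed.

(** As v' has zero mean and v' <= L, the integral of |v'| is at most that of
    2 L - v', which is 2 L. *)
Lemma mode_energy_bound v L n : smooth v -> periodic1 v -> 0 <= L ->
  (forall x, v^`() x <= L) -> n%:R ^+ 2 * mode_energy v n <= L ^+ 2.
Proof.
move=> sv pv L0 vL.
have sv' := smooth_deriv sv; have cv' := smooth_continuous sv'.
have int0 : torus_int v^`() = 0.
  have := cos_coef_deriv 0 sv pv; rewrite /freq mulr0 mul0r => <-.
  by apply: eq_torus_int => x; rewrite /freq mulr0 mul0r cos0 mulr1.
have cB : continuous (fun x => 2 * L - v^`() x).
  by move=> x; apply: cvgB; [exact: cvg_cst|exact: cv'].
have iB : torus_int (fun x => 2 * L - v^`() x) = 2 * L.
  rewrite torus_intB//; last exact: cst_continuous.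
  by rewrite torus_int_cst int0 subr0.
have bnd (s : R -> R) : continuous s -> (forall x, `|s x| <= 1) ->
    `|torus_int (fun x => v^`() x * s x)| <= 2 * L.
  move=> cs s1; rewrite -iB; apply: le_norm_torus_int => //.
    exact: continuous_mul.
  move=> x _; rewrite normrM; apply: (@le_trans _ _ `|v^`() x|).
    by rewrite ler_piMr.
  by have := vL x; rewrite ler_norml; clear -L0; lra.
have cb : `|cos_coef v^`() n| <= 2 * L.
  by apply: bnd; [exact: continuous_cosM|move=> x; exact: cos_max].
have sb : `|sin_coef v^`() n| <= 2 * L.
  by apply: bnd; [exact: continuous_sinM|move=> x; exact: sin_max].
have sq c : `|c| <= 2 * L -> c ^+ 2 <= (2 * L) ^+ 2.
  by move=> cL; rewrite -real_normK ?num_real// lerXn2r ?nnegrE ?mulr_ge0.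
have := sq _ cb; have := sq _ sb.
rewrite (cos_coef_deriv n sv pv) (sin_coef_deriv n sv pv) sqrrN /mode_energy.
have f4 : 16 * n%:R ^+ 2 <= freq n ^+ 2 :> R.
  have -> : 16 * n%:R ^+ 2 = (4 * n%:R) ^+ 2 :> R by rewrite exprMn; ring.
  rewrite lerXn2r ?nnegrE ?freq_ge0 ?mulr_ge0//.
  by rewrite /freq ler_wpM2r//; have := @pi_ge2 R; lra.
move: (freq n) f4 => fr f4; rewrite !exprMn.
move: (cos_coef v n ^+ 2) (sqr_ge0 (cos_coef v n)) => C C0.
move: (sin_coef v n ^+ 2) (sqr_ge0 (sin_coef v n)) => S S0.
have CS : 0 <= C + S by exact: addr_ge0.
move=> h1 h2; have := ler_wpM2r CS f4.
move: (n%:R ^+ 2) (fr ^+ 2) (L ^+ 2) (sqr_ge0 L) h1 h2 => p q r r0 h1 h2 h3.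
clear -h1 h2 h3 r0; lra.
Qed.

Lemma sum_ltn_le N m : \sum_(i < N) (i < m)%:R <= m%:R :> R.
Proof.
suff -> : \sum_(i < N) (i < m)%:R = (minn N m)%:R :> R by rewrite ler_nat geq_minr.
elim: N => [|N IHN]; first by rewrite big_ord0 min0n.
rewrite big_ord_recr/= IHN -natrD; congr (_%:R).
case: ltnP => h; first by rewrite addn1; apply/esym/minn_idPl.
by rewrite addn0; apply/esym/minn_idPr; exact: leqW.
Qed.

(** The factor 2 counts n and - n, for G depending on |n| only; the shell is
    k <= |n| M and |n| <= M k since M is a natural number. *)
Definition shell_sum M k (G : nat -> R) : R :=
  \sum_(i < M * k) if (k <= i.+1 * M)%N then 2 * G i.+1 else 0.

Lemma fsum_shell M k (G : nat -> R) : (0 < M)%N -> (0 < k)%N ->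
  \sum_(n \in shell (M%:R : R) k) G (absz n) = shell_sum M k G.
Proof.
move=> M0 k0.
pose J : set int := [set n : int | (k <= absz n * M)%N].
have -> : shell (M%:R : R) k = [set n : int | (absz n <= M * k)%N] `&` J :> set int.
  have E (n : int) : `|n%:~R| = (absz n)%:R :> R by rewrite -intr_norm -abszE.
  apply/seteqP; split => n; rewrite /shell/J/= E mulrC ler_pdivrMr ?ltr0n// -!natrM !ler_nat.
    by move=> /andP[-> ->].
  by move=> [-> ->].
rewrite fsbig_mkcondr fsum_ball ifF ?add0r; last first.
  by apply/negP; rewrite inE /J/= mul0n leqNgt k0.
apply: eq_bigr => i _.
have -> : (Posz i.+1 \in J) = (k <= i.+1 * M)%N by apply/idP/idP; rewrite inE.
have -> : (Negz i \in J) = (k <= i.+1 * M)%N by apply/idP/idP; rewrite inE.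
by case: ifP => _; rewrite ?addr0//= mulr2n mulrDl mul1r.
Qed.

Lemma shell_sum_le M k (G : nat -> R) c : (0 < k)%N ->
  (forall n, (k <= n * M)%N -> G n <= c) ->
  shell_sum M k G <= c * shell_sum M k (fun=> 1).
Proof.
move=> k0 Gc; rewrite /shell_sum mulr_sumr; apply: ler_sum => i _.
by case: ifP => [h|_]; rewrite ?mulr0// mulr1 mulrC ler_pM2r// Gc.
Qed.

Lemma shell_sum_one_le M k : shell_sum M k (fun=> 1) <= 2 * (M%:R * k%:R).
Proof.
rewrite -natrM -[X in 2 * X%:R]card_ord mulr_natr -sumr_const.
by apply: ler_sum => i _; case: ifP; rewrite ?mulr1.
Qed.

(** Low frequencies (n M < k) are at most k / M in number and each contributes
    at most 8 pi^2 b l^2 with l = 1/k; high frequencies (n > M k) contribute at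
    most 8 b l / M in total; in between 1 - cos <= 2. *)
Lemma shell_lower_bound v b s M k : smooth v -> periodic1 v ->
    (0 < M)%N -> (0 < k)%N -> 0 <= b -> 
    (forall n, n%:R ^+ 2 * mode_energy v n <= b) ->
    s * k%:R^-1 <= torus_int (fun x => (v (x + k%:R^-1) - v x) ^+ 2) ->
  s * k%:R^-1 <= (8 * pi ^+ 2 + 8) * b / M%:R * k%:R^-1 +
                 4 * shell_sum M k (mode_energy v).
Proof.
move=> sv pv M0 k0 b0 vb.
set l : R := k%:R^-1.
have k0' : 0 < k%:R :> R by rewrite ltr0n.
have M0' : 0 < M%:R :> R by rewrite ltr0n.
have kl : k%:R * l = 1 by rewrite mulfV// gt_eqF.
have l0 : 0 < l by rewrite invr_gt0.
have l1 : 0 <= l <= 1 by rewrite (ltW l0) invf_le1// ler1n.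
move=> /le_trans hs.
have [B B0 vB] := increment_energy_le sv pv l1.
have E0 n : 0 <= mode_energy v n by rewrite addr_ge0 ?sqr_ge0.
pose t i := 4 * (1 - cos (freq i.+1 * l)) * mode_energy v i.+1.
have c2 i : 0 <= 1 - cos (freq i * l) <= 2.
  have := cos_le1 (freq i * l); have := cos_geN1 (freq i * l); clear; lra.
have tb i : i.+1%:R ^+ 2 * `|t i| <= 8 * b.
  have /andP[c0 c2'] := c2 i.+1.
  rewrite ger0_norm ?mulr_ge0//.
  have := vb i.+1; have := E0 i.+1; rewrite /t.
  have := sqr_ge0 (i.+1%:R : R).
  move: (mode_energy v i.+1) (1 - _) (i.+1%:R ^+ 2) c0 c2' => e c p c0 c2' p0 e0 pe.
  have pe0 : 0 <= p * e by exact: mulr_ge0.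
  have -> : p * (4 * c * e) = 4 * (c * (p * e)) by ring.
  clear -c0 c2' pe0 pe; nra.
have head : \sum_(i < M * k) t i <=
    8 * pi ^+ 2 * b / M%:R * l + 4 * shell_sum M k (mode_energy v).
  have ti i : t i <= 8 * pi ^+ 2 * b * l ^+ 2 * (i < k %/ M)%:R +
      4 * (if (k <= i.+1 * M)%N then 2 * mode_energy v i.+1 else 0).
    have p2 : 0 <= 8 * pi ^+ 2 * b * l ^+ 2.
      by rewrite !mulr_ge0 ?sqr_ge0 ?(ltW l0) ?pi_ge0.
    have /andP[c0 c2'] := c2 i.+1.
    case: (leqP k (i.+1 * M)) => ki.
      apply: (@le_trans _ _ (4 * (2 * mode_energy v i.+1))); last first.
        by rewrite lerDr mulr_ge0.
      by rewrite /t mulrA ler_wpM2r// ler_wpM2l.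
    have -> : (i < k %/ M)%N.
      by rewrite leq_divRL// ltnW.
    rewrite mulr0 addr0 mulr1 /t.
    have /andP[_ h] := @one_sub_cos_bound R (i.+1%:R * l).
    have {}h : 1 - cos (freq i.+1 * l) <= 2 * pi ^+ 2 * (i.+1%:R * l) ^+ 2.
      rewrite /freq -mulrA; apply: le_trans h _.
      by rewrite ler_wpM2l ?mulr_ge0 ?sqr_ge0// ?pi_ge0// ge_min lexx orbT.
    apply: le_trans (ler_wpM2r (E0 _) (ler_wpM2l _ h)) _ => //.
    have -> : 4 * (2 * pi ^+ 2 * (i.+1%:R * l) ^+ 2) * mode_energy v i.+1 =
      8 * pi ^+ 2 * l ^+ 2 * (i.+1%:R ^+ 2 * mode_energy v i.+1) by ring.
    rewrite [leRHS]mulrAC ler_wpM2l//.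
    by rewrite !mulr_ge0 ?pi_ge0 ?(ltW l0).
  apply: (@le_trans _ _ (\sum_(i < M * k) (8 * pi ^+ 2 * b * l ^+ 2 * (i < k %/ M)%:R +
      4 * (if (k <= i.+1 * M)%N then 2 * mode_energy v i.+1 else 0)))).
    by apply: ler_sum => i _; exact: ti.
  rewrite big_split/= -mulr_sumr -mulr_sumr lerD2r.
  have := sum_ltn_le (M * k) (k %/ M).
  have : (k %/ M)%:R <= k%:R / M%:R :> R.
    by rewrite ler_pdivlMr// -natrM ler_nat leq_divM.
  move=> /[swap] /le_trans /[apply].
  have p2 : 0 <= 8 * pi ^+ 2 * b * l ^+ 2.
    by rewrite !mulr_ge0 ?(ltW l0) ?pi_ge0.
  move=> /(ler_wpM2l p2) /le_trans; apply.
  have -> : 8 * pi ^+ 2 * b * l ^+ 2 * (k%:R / M%:R) =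
    8 * pi ^+ 2 * b / M%:R * l * (k%:R * l) by ring.
  by rewrite kl mulr1.
have Mk0 : (0 < M * k)%N by rewrite muln_gt0 M0.
have all N : (M * k <= N.+1)%N -> s * l <= (8 * pi ^+ 2 + 8) * b / M%:R * l +
    4 * shell_sum M k (mode_energy v) + B * N.+1%:R^-1.
  move=> MN; have := hs _ (vB N).
  have := @quadratic_tail R t _ (M * k) N.+1 tb.
  rewrite Mk0 MN => /(_ isT); rewrite ler_norml => /andP[_].
  have -> : 8 * b / (M * k)%:R = 8 * b / M%:R * l by rewrite natrM invfM mulrA.
  have -> : (8 * pi ^+ 2 + 8) * b / M%:R * l =
     8 * pi ^+ 2 * b / M%:R * l + 8 * b / M%:R * l by ring.
  move=> h1 h2; have {}h2 : s * l <= \sum_(i < N.+1) t i + B / N.+1%:R by exact: h2.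
  move: h1 h2 head; move: (\sum_(i < N.+1) t i) (\sum_(i < M * k) t i)
    (8 * pi ^+ 2 * b / M%:R * l) (8 * b / M%:R * l) (shell_sum _ _ _)
    (B / N.+1%:R) (s * l) => p1 p2 p3 p4 p5 p6 p7.
  clear; lra.
rewrite -[leRHS]addr0 -(mulr0 B).
have lim : (fun N => (8 * pi ^+ 2 + 8) * b / M%:R * l +
    4 * shell_sum M k (mode_energy v) + B * N.+1%:R^-1) @ \oo -->
    (8 * pi ^+ 2 + 8) * b / M%:R * l + 4 * shell_sum M k (mode_energy v) + B * 0.
  apply: cvgD; first exact: cvg_cst.
  by apply: cvgM; [exact: cvg_cst|exact: cvg_harmonic].
apply: (cvgr_to_ge lim); near=> N; apply: all.
apply: leqW; near: N; exact: nbhs_infty_ge.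
Unshelve. all: by end_near. Qed.

End Spectrum.

(** * Averages in time *)

Section TimeIntegral.
Context {R : realType}.
Implicit Types (a b c t x : R) (n k M : nat).
Local Notation mu := (@lebesgue_measure R).

(** Lebesgue measure is given by an outer measure, hence is monotone on
    arbitrary sets; this is how it is used for L_K. *)
Lemma lebesgue_measure_le (A B : set R) : A `<=` B -> (mu A <= mu B)%E.
Proof. by move=> AB; exact: le_outer_measure. Qed.

Lemma continuous_torus_int_param (W : R * R -> R) : continuous W ->
  continuous (fun t => torus_int (fun x => W (t, x))).
Proof.
move=> cW a.
have cA : compact (`[a - 1, a + 1]%classic `*` `[0, 1]%classic : set (R * R)).
  by apply: compact_setX; exact: segment_compact.
have A0 : (`[a - 1, a + 1]%classic `*` `[0, 1]%classic : set (R * R)) !=set0.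
  by exists (a, 0); split; rewrite /= in_itv/= ?lexx ?ler01//; apply/andP; split; lra.
have cn : continuous (fun p => `|W p|) by move=> p; apply: cvg_norm; exact: cW.
(* Dominate by the maximum of |W| near time a. *)
have [p0 _ pmax] := compact_EVT_max A0 cA (continuous_subspaceT cn).
have c1 t : continuous (fun x => W (t, x)).
  move=> x; apply: (@continuous_comp _ _ _ (fun x => (t, x)) W); last exact: cW.
  exact: (cvg_pair (cvg_cst t) cvg_id).
have c2 x : continuous (fun t => W (t, x)).
  move=> t; apply: (@continuous_comp _ _ _ (fun t => (t, x)) W); last exact: cW.
  exact: (cvg_pair cvg_id (cvg_cst x)).
apply: (@continuity_under_integral R _ _ mu (fun t x => W (t, x)) `[0, 1]%classic
  (measurable_itv _) (a - 1) (a + 1) _ _ (fun=> `|W p0|)).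
- by move=> t _; exact: continuous_itv_integrable.
- by apply: aeW => x _ t _; exact: c2.
- by apply: continuous_itv_integrable; exact: cst_continuous.
- move=> t; rewrite /= in_itv/= => /andP[t1 t2]; apply: aeW => x /=.
  move=> x01; apply: pmax; apply/mem_set; split => //=.
  by rewrite in_itv/= !ltW.
- by apply/mem_set; rewrite /= in_itv/=; apply/andP; split; lra.
Qed.

Lemma continuous_mode_energy u n : smooth_halfplane u ->
  continuous (fun t => mode_energy (u (Num.max 0 t)) n).
Proof.
move=> su; have cu := halfplane_continuous su.
have cx (g : R -> R) : continuous g ->
    continuous (fun t => torus_int (fun x => u (Num.max 0 t) x * g x)).
  move=> cg.
  apply: (@continuous_torus_int_param (fun p => u (Num.max 0 p.1) p.2 * g p.2)).
  move=> p; apply: cvgM; first exact: cu.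
  apply: (@continuous_comp _ _ _ snd g); last exact: cg.
  exact: cvg_snd.
have cc : continuous (fun t => cos_coef (u (Num.max 0 t)) n).
  by apply: cx; exact: continuous_cosM.
have cs : continuous (fun t => sin_coef (u (Num.max 0 t)) n).
  by apply: cx; exact: continuous_sinM.
have -> : (fun t => mode_energy (u (Num.max 0 t)) n) = (fun t =>
    cos_coef (u (Num.max 0 t)) n * cos_coef (u (Num.max 0 t)) n +
    sin_coef (u (Num.max 0 t)) n * sin_coef (u (Num.max 0 t)) n).
  by apply/funext => t; rewrite /mode_energy !expr2.
by move=> t; apply: cvgD; apply: cvgM; [exact: cc|exact: cc|exact: cs|exact: cs].
Qed.

(** Constant for negative times, hence continuous on the whole line. *)
Definition shell_mean u M k t : R :=
  shell_sum M k (mode_energy (u (Num.max 0 t))) / shell_sum M k (fun=> 1).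

Lemma continuous_shell_mean u M k : smooth_halfplane u ->
  continuous (shell_mean u M k).
Proof.
move=> su t; apply: cvgM; last exact: cvg_cst.
apply: (@continuous_sum _ _ (fun i t => if (k <= i.+1 * M)%N then
  2 * mode_energy (u (Num.max 0 t)) i.+1 else 0)) => i s.
case: (k <= i.+1 * M)%N; last exact: cvg_cst.
by apply: cvgM; [exact: cvg_cst|exact: continuous_mode_energy].
Qed.

Lemma shell_mean_ge0 u M k t : 0 <= shell_mean u M k t.
Proof.
apply: divr_ge0; apply: sumr_ge0 => i _; case: ifP => // _.
by rewrite mulr_ge0// addr_ge0 ?sqr_ge0.
Qed.

Lemma spectrum_shell_mean u M k t1 t2 : smooth_halfplane u -> 0 <= t1 ->
  (0 < M)%N -> (0 < k)%N ->
  spectrum t1 t2 M%:R u k = time_average t1 t2 (shell_mean u M k).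
Proof.
move=> su t10 M0 k0; rewrite /spectrum /time_average; congr (_ * _).
apply: eq_Rintegral => t; rewrite inE/= in_itv/= => /andP[t1t _].
have t0 : 0 <= t by exact: le_trans t1t.
have cv := smooth_continuous (smooth_slice su t0).
rewrite /shell_mean max_r//; congr (_ / _).
  rewrite -fsum_shell//; apply: eq_fsbigr => n _.
  exact: sq_modulus_fourier.
by rewrite -fsum_shell.
Qed.

Lemma time_average_le t1 t2 (F : R -> R) c : continuous F -> t1 < t2 ->
  (forall t, t1 <= t <= t2 -> F t <= c) -> time_average t1 t2 F <= c.
Proof.
move=> cF t12 Fc; rewrite /time_average ler_pdivrMl ?subr_gt0//.
have -> : (t2 - t1) * c = \int[mu]_(s in `[t1, t2]) c.
  by rewrite Rintegral_cst//= lebesgue_measure_itv/= lte_fin t12 -EFinD/= mulrC.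
apply: le_Rintegral => //; first exact: continuous_itv_integrable.
by apply: continuous_itv_integrable; exact: cst_continuous.
Qed.

(** The set A is enclosed in the part of [t1, t2] where c <= F, which is
    measurable because F is continuous. *)
Lemma le_time_average t1 t2 (F : R -> R) c m (A : set R) :
    continuous F -> t1 < t2 -> (forall t, 0 <= F t) -> 0 <= c ->
    (forall t, A t -> t1 <= t <= t2 /\ c <= F t) -> (m%:E <= mu A)%E ->
  c * m / (t2 - t1) <= time_average t1 t2 F.
Proof.
move=> cF t12 F0 c0 Ac mA.
pose I : set R := `[t1, t2]%classic.
pose B : set R := I `&` (F @^-1` `[c, +oo[%classic).
have mI : measurable I by exact: measurable_itv.
have mB : measurable B.
  apply: measurableI => //.
  have := continuous_measurable_fun cF.
  move=> /(_ measurableT `[c, +oo[%classic (measurable_itv _)).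
  by rewrite setTI.
have BI : B `<=` I by exact: subIsetl.
have muI : mu I = (t2 - t1)%:E by rewrite lebesgue_measure_itv/= lte_fin t12 -EFinD.
have AB : A `<=` B.
  by move=> t /Ac[h1 h2]; split; rewrite /I/= in_itv/= ?andbT.
have muB : (mu B <= (t2 - t1)%:E)%E by rewrite -muI lebesgue_measure_le.
have fB : mu B \is a fin_num by rewrite ge0_fin_numE// (le_lt_trans muB)// ltry.
have mB' : m <= fine (mu B).
  rewrite -lee_fin fineK//; apply: le_trans mA _; exact: lebesgue_measure_le.
rewrite /time_average mulrC ler_wpM2l ?invr_ge0 ?subr_ge0 ?(ltW t12)//.
apply: (@le_trans _ _ (c * fine (mu B))); first by rewrite ler_wpM2l.
rewrite -Rintegral_cst//.
have iF : mu.-integrable I (EFin \o F) by exact: continuous_itv_integrable.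
have iFB : mu.-integrable B (EFin \o F) by exact: integrableS iF.
have icB : mu.-integrable B (EFin \o (fun=> c)).
  apply: (@integrableS _ _ _ mu I) => //.
  by apply: continuous_itv_integrable; exact: cst_continuous.
apply: (@le_trans _ _ (\int[mu]_(t in B) F t)).
  apply: le_Rintegral => // t [_]; rewrite /= in_itv/= andbT.
  by [].
rewrite /Rintegral fine_le ?integrable_fin_num//.
apply: ge0_subset_integral => //; first exact: (measurable_int mu).
by move=> s _; rewrite lee_fin.
Qed.

End TimeIntegral.

(** * The scale nu^beta and the set L_K *)

Section Assembly.
Context {R : realType}.
Implicit Types (alpha nu K t x : R) (u : R -> R -> R).

Lemma betaexp_gt0 alpha : 1 < alpha -> 0 < betaexp alpha.
Proof. by move=> a1; rewrite invr_gt0 subr_gt0. Qed.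

(** The smallness of nu_0 makes K^-1 nu^-beta larger than K, so a slope of
    that size cannot be positive. *)
Lemma powR_beta_small alpha K nu : 1 < alpha -> 1 < K ->
    0 < nu <= nu_0 alpha K ->
  [/\ nu <= 1, 0 < nu `^ betaexp alpha & nu `^ betaexp alpha <= 6^-1 * K ^- 2].
Proof.
move=> a1 K1 /andP[nu0 nuK]; have b0 := betaexp_gt0 a1.
have K0 : 0 < K by lra.
have x0 : 0 < 6^-1 * K ^- 2 :> R by rewrite mulr_gt0// invr_gt0 exprn_gt0.
have x1 : 6^-1 * K ^- 2 <= 1 :> R.
  have : K ^- 2 <= 1 by rewrite invf_le1 ?exprn_gt0// exprn_ege1// ltW.
  by clear -x0; lra.
split.
- apply: le_trans nuK _; rewrite /nu_0.
  have bi : 0 <= (betaexp alpha)^-1 by rewrite invr_ge0 ltW.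
  suff : (6^-1 * K ^- 2) `^ (betaexp alpha)^-1 <= 1 `^ (betaexp alpha)^-1.
    by rewrite powR1.
  by apply: ge0_ler_powR; rewrite ?nnegrE ?ler01 ?(ltW x0).
- exact: powR_gt0.
- have : nu `^ betaexp alpha <= nu_0 alpha K `^ betaexp alpha.
    by apply: ge0_ler_powR; rewrite ?nnegrE ?(ltW b0) ?(ltW nu0) ?(le_trans (ltW nu0) nuK).
  by rewrite /nu_0 -powRrM mulVf ?gt_eqF// powRr1 ?(ltW x0).
Qed.

(** The maximum of |u_x| is attained, and the value there cannot be positive
    since u_x <= K < K^-1 nu^-beta. *)
Lemma L_set_cliff alpha t1 t2 nu K u t :
    smooth_halfplane u -> periodic1 (u t) -> 0 <= t -> 1 < K ->
    0 < nu `^ betaexp alpha -> nu `^ betaexp alpha <= 6^-1 * K ^- 2 ->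
    L_set alpha t1 t2 nu K u t ->
  [/\ forall x, (u t)^`() x <= K,
      exists x0, (u t)^`() x0 <= - (K^-1 * (nu `^ betaexp alpha)^-1) &
      forall x, `|(u t)^`()^`() x| <= K * (nu `^ betaexp alpha) ^- 2].
Proof.
move=> su pt t0 K1 e0 eK [_ _ supK /andP[n1 _] n2].
have st := smooth_slice su t0.
have s1 := smooth_deriv st; have p1 := periodic_deriv pt.
have s2 := smooth_deriv s1; have p2 := periodic_deriv p1.
rewrite powRN in n1; rewrite powRN (mulrC 2) powRrM in n2.
set e := nu `^ betaexp alpha in e0 eK n1 n2 *.
rewrite (powR_mulrn 2 (ltW e0)) in n2.
have c1 := smooth_continuous s1.
have uK x : (u t)^`() x <= K.
  apply: le_trans supK; apply: sup_upper_bound; last by exists x.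
  have [B B0 uB] := periodic_bounded c1 p1.
  split; first by exists ((u t)^`() 0), 0.
  by exists B => _ [y _ <-]; apply: le_trans (ler_norm _) (uB y).
split=> //.
- have cn : continuous (fun x => `|(u t)^`() x|).
    by move=> x; apply: cvg_norm; exact: c1.
  have [x0 _ xmax] := EVT_max ler01 (continuous_subspaceT cn).
  exists x0.
  have : K^-1 * e^-1 <= `|(u t)^`() x0|.
    apply: le_trans n1 _; apply: Linfty_norm_le => // x.
    have [y y01 yE] := periodic_reduce x p1.
    have -> : (u t)^`(1)%classic x = (u t)^`() y by exact: yE.
    by apply: xmax; rewrite in_itv.
  have K0 : 0 < K by lra.
  have : K < K^-1 * e^-1.
    rewrite -invfM -ltf_pV2 ?posrE ?invr_gt0 ?mulr_gt0// invrK.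
    apply: le_lt_trans (ler_wpM2l (ltW K0) eK) _.
    have -> : K * (6^-1 * K ^- 2) = 6^-1 * K^-1 by field; rewrite gt_eqF.
    have : 0 < K^-1 by rewrite invr_gt0.
    by clear; lra.
  have := uK x0; rewrite ler_normr.
  move: (K^-1 * e^-1) ((u t)^`() x0) => p q; clear.
  by move=> h1 h2 /orP[h3|h3]; lra.
- move=> x; apply: le_trans n2.
  exact: (le_Linfty_norm x (smooth_continuous s2) p2).
Qed.

End Assembly.

(** * The spectral estimate *)

Theorem theorem7p8 (R : realType) (alpha : R) (halpha : 1 < alpha < 2)
    (sigma : R) (f : R -> R) (hf : flux sigma f)
    (D : R) (hD : 1 < D)
    (Ct : R) (hCt : energy_constant alpha f D Ct)
    (C K : R) (hCK : L_constants alpha sigma f D Ct C K) :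
  exists2 M : R, 1 <= M &
  exists2 c : R, 0 < c &
  forall (nu : R) (u0 : R -> R) (u : R -> R -> R),
    0 < nu <= nu_0 alpha K ->
    initial_datum D u0 ->
    solution alpha f nu u0 u ->
    forall k : nat, (1 <= k)%N ->
      C_1 K * nu `^ betaexp alpha < k%:R^-1 <= C_2 K ->
      spectrum (T1 D Ct) (T2 sigma D Ct) M u k <= c * k%:R ^- 2 /\
      k%:R ^- 2 <= c * spectrum (T1 D Ct) (T2 sigma D Ct) M u k.
Proof.
have [C0 K1 hL] := hCK.
have [Ct0 _] := hCt.
have a1 : 1 < alpha by case/andP: halpha.
have K0 : 0 < K by lra.
have D0 : 0 < D by lra.
pose t1 := T1 D Ct; pose t2 := T2 sigma D Ct.
have t10 : 0 < t1.
  by rewrite /t1 /T1 !mulr_gt0 ?invr_gt0 ?exprn_gt0.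
have t12 : t1 < t2.
  apply: (@lt_le_trans _ _ (3 / 2 * t1)); first by clear -t10; lra.
  by rewrite /t2 /T2 le_max lexx.
pose s := cliff_constant K.
have s0 : 0 < s.
  by rewrite mulr_gt0 ?invr_gt0// exprn_gt0// mulr_gt0 ?invr_gt0 ?exprn_gt0.
pose b := D ^+ 2.
have b0 : 0 < b by rewrite exprn_gt0.
pose Q : R := (8 * pi ^+ 2 + 8) * b.
have Q0 : 0 <= Q.
  by rewrite mulr_ge0 ?(ltW b0)// addr_ge0// mulr_ge0// sqr_ge0.
pose M := (Num.bound (2 * Q / s)).+1.
have M0 : (0 < M)%N by [].
have M0' : 0 < M%:R :> R by [].
have MQ : Q / M%:R <= s / 2.
  rewrite ler_pdivrMr// -ler_pdivrMl ?divr_gt0//.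
  have : 2 * Q / s < M%:R.
    have Qs : 0 <= 2 * Q / s by apply: divr_ge0; [exact: mulr_ge0|exact: ltW].
    apply: lt_le_trans (archi_boundP Qs) _.
    by rewrite ler_nat.
  by move/ltW; apply: le_trans; rewrite invf_div mulrAC.
pose c1 := b * M%:R ^+ 2.
pose c2 := 16 * M%:R * (t2 - t1) / (s * C).
have c10 : 0 < c1 by rewrite mulr_gt0// exprn_gt0.
have c20 : 0 < c2.
  by apply: divr_gt0; apply: mulr_gt0; rewrite ?subr_gt0// mulr_gt0.
exists M%:R; first by rewrite ler1n.
exists (c1 + c2); first exact: addr_gt0.
move=> nu u0 u hnu hu0 hu k k1 hk.
have [nu1 e0 eK] := powR_beta_small a1 K1 hnu.
have nu0 : 0 < nu by case/andP: hnu.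
have [su pu _ _ _] := hu.
have [su0 pu0 _ _ DE] := hu0.
have u0D x : u0^`() x <= D.
  apply: le_trans (ler_norm _) _; rewrite DE le_max.
  apply/orP; right.
  exact: (le_Linfty_norm x (smooth_continuous (smooth_deriv su0)) (periodic_deriv pu0)).
have osl := one_sided_lipschitz halpha hf nu0 hu su0 D0 u0D.
have k0 : 0 < k%:R :> R by rewrite ltr0n.
have modes t n : 0 <= t -> n%:R ^+ 2 * mode_energy (u t) n <= b.
  move=> t0; apply: mode_energy_bound (smooth_slice su t0) (pu t t0) (ltW D0) _ => x.
  apply: deriv_le_increment; first exact: smooth_slice.
  by move=> h h01; exact: osl.
rewrite spectrum_shell_mean ?(ltW t10)//.
set F := shell_mean u M k.
have cF : continuous F by exact: continuous_shell_mean.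
have F0 t : 0 <= F t by exact: shell_mean_ge0.
set N := shell_sum M k (fun=> 1 : R).
have N0 : 0 <= N by apply: sumr_ge0 => i _; case: ifP => // _; rewrite mulr_ge0.
have high n t : 0 <= t -> (k <= n * M)%N -> mode_energy (u t) n <= c1 * k%:R ^- 2.
  move=> t0 kn.
  have n0 : (0 < n)%N by move: kn; case: n => //; rewrite mul0n leqNgt k1.
  have knR : k%:R ^+ 2 <= (n%:R * M%:R) ^+ 2 :> R.
    by rewrite lerXn2r ?nnegrE ?mulr_ge0// -natrM ler_nat.
  rewrite ler_pdivlMr ?exprn_gt0//.
  have E0 : 0 <= mode_energy (u t) n by rewrite addr_ge0 ?sqr_ge0.
  apply: le_trans (ler_wpM2l E0 knR) _.
  have -> : mode_energy (u t) n * (n%:R * M%:R) ^+ 2 =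
    n%:R ^+ 2 * mode_energy (u t) n * M%:R ^+ 2 by ring.
  by rewrite ler_wpM2r ?sqr_ge0// modes.
have upper t : 0 <= t -> F t <= c1 * k%:R ^- 2.
  move=> t0; rewrite /F /shell_mean max_r//.
  have [NE|NN0] := eqVneq N 0.
    by rewrite -/N NE invr0 mulr0 mulr_ge0 ?invr_ge0 ?exprn_ge0 ?ltW.
  rewrite ler_pdivrMr; last by rewrite lt_neqAle eq_sym NN0.
  by apply: shell_sum_le => // n; exact: high.
have k20 : 0 <= k%:R ^- 2 :> R by rewrite invr_ge0 exprn_ge0.
split.
  apply: (@le_trans _ _ (c1 * k%:R ^- 2)).
    apply: time_average_le => // t /andP[t1t _]; apply: upper.
    exact: le_trans (ltW t10) t1t.
  by rewrite ler_wpM2r// lerDl ltW.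
pose c3 := s / (16 * M%:R).
have c30 : 0 < c3 by rewrite divr_gt0// mulr_gt0.
have lower t : L_set alpha t1 t2 nu K u t ->
    t1 <= t <= t2 /\ c3 * k%:R ^- 2 <= F t.
  move=> Lt; have [tt _ _ _ _] := Lt; split => //.
  have t0 : 0 <= t by case/andP: tt => t1t _; exact: le_trans (ltW t10) t1t.
  have [uK [x0 ux0] u2] := L_set_cliff su (pu t t0) t0 K1 e0 eK Lt.
  have st := smooth_slice su t0.
  have inc := cliff_increment st (pu t t0) K1 e0 uK ux0 u2 hk.
  have := shell_lower_bound st (pu t t0) M0 k1 (ltW b0) (fun n => modes t n t0) inc.
  rewrite -/s -/Q.
  have kV : 0 <= k%:R^-1 :> R by rewrite invr_ge0.
  have := ler_wpM2r kV MQ.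
  set S := shell_sum _ _ _; move=> h1 h2.
  have {h1 h2}hS : s / 8 * k%:R^-1 <= S.
    move: h1 h2; move: (k%:R^-1) (Q / M%:R) => l q; clear; lra.
  have S0 : 0 < S.
    by apply: lt_le_trans hS; rewrite mulr_gt0 ?invr_gt0 ?divr_gt0.
  have NN : 0 < N.
    rewrite lt_neqAle N0 andbT; apply/eqP => NE.
    have : S <= c1 * k%:R ^- 2 * N by apply: shell_sum_le => // n; exact: high.
    by rewrite -NE mulr0 leNgt S0.
  rewrite /F /shell_mean max_r// -/S -/N ler_pdivlMr//.
  have N2 : N <= 2 * (M%:R * k%:R) by exact: shell_sum_one_le.
  have c3k : 0 <= c3 * k%:R ^- 2 by rewrite mulr_ge0// ltW.
  apply: le_trans (ler_wpM2l c3k N2) _; apply: le_trans hS.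
  rewrite le_eqVlt; apply/orP; left; apply/eqP; rewrite /c3.
  by field; rewrite !gt_eqF.
have c3k : 0 <= c3 * k%:R ^- 2 by rewrite mulr_ge0// ltW.
have nu01 : 0 < nu <= 1 by rewrite nu0 nu1.
have mL := hL K (lexx K) nu u0 u nu01 hu0 hu.
have := le_time_average cF t12 F0 c3k lower mL.
set A := time_average _ _ _ => hA.
have A0 : 0 <= A.
  apply: le_trans hA; apply: divr_ge0; last by rewrite subr_ge0 ltW.
  by rewrite mulr_ge0// ltW.
apply: (@le_trans _ _ (c2 * A)); last by rewrite ler_wpM2r// lerDr ltW.
apply: le_trans (ler_wpM2l (ltW c20) hA).
rewrite le_eqVlt; apply/orP; left; apply/eqP; rewrite /c2 /c3.
by field; rewrite !gt_eqF// subr_gt0.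
Qed.
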